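(* Let $0\leq \beta < 1$ and $q = 1/(1-\beta)$. Let $f:\mathbb{R} \to \mathbb{R}$ be a function of bounded variation such that $\widetilde{M}_{\beta}f \not\equiv \infty$. Then $\widetilde{M}_{\beta}f$ is absolutely continuous and its derivative satisfies $$\big\|\big(\widetilde{M}_{\beta}f\big)'\big\|_{L^q(\mathbb{R})} = \mathrm{Var}_q\big(\widetilde{M}_{\beta}f\big) \leq 8^{1/q}\,\mathrm{Var}(f).$$
   Context: For $0\le\beta<1$ and a (locally integrable) function $f:\mathbb{R}\to\mathbb{R}$, the one-dimensional uncentered fractional maximal function is the $[0,\infty]$-valued function $$\widetilde{M}_{\beta}f(x) = \sup_{\substack{r,s\geq 0 \\ r+s >0}} \frac{1}{(r+s)^{1 - \beta}} \int_{x-r}^{x+s} |f(y)|\,dy .$$ $\mathrm{Var}(f)$ denotes the total variation of $f$ on $\mathbb{R}$. For $g:\mathbb{R}\to\mathbb{R}$ and $1\le q<\infty$, the (Riesz) $q$-variation of $g$ is $$\mathrm{Var}_q(g) := \sup_{\mathcal{P}} \left(\sum_{n=1}^{N-1} \frac{|g(x_{n+1}) - g(x_n)|^q}{|x_{n+1} - x_n|^{q-1} }\right)^{1/q},$$ where the supremum is over all finite partitions $\mathcal{P} = \{x_1 < x_2 < \ldots < x_N\}$ of points of $\mathbb{R}$. *)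

(* Defs.v *)
From HB Require Import structures.
From mathcomp Require Import all_boot all_order all_algebra.
From mathcomp Require Import all_classical all_reals all_analysis.

Set Implicit Arguments.
Unset Strict Implicit.
Unset Printing Implicit Defensive.

Import Order.TTheory GRing.Theory Num.Theory.
Import numFieldNormedType.Exports.

Local Open Scope classical_set_scope.
Local Open Scope ring_scope.

Definition frac_maximal (R : realType) (beta : R) (f : R -> R) (x : R) : \bar R :=
  ereal_sup
    [set ((((rs.1 + rs.2) `^ (1 - beta))^-1)%:E
          * \int[lebesgue_measure]_(y in `[(x - rs.1)%R, (x + rs.2)%R]) `|f y|%:E)%E
    | rs in [set rs : R * R | [/\ 0 <= rs.1, 0 <= rs.2 & 0 < rs.1 + rs.2]]].

(* Total variation on the whole line, in terms of the variation on compact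
   intervals. *)
Definition total_variation_line (R : realType) (f : R -> R) : \bar R :=
  ereal_sup [set total_variation ab.1 ab.2 f
            | ab in [set ab : R * R | ab.1 <= ab.2]].

(* Riesz q-variation; a partition x_1 < ... < x_N is a strictly sorted
   sequence, indexed from 0. Empty and one-point sequences contribute 0. *)
Definition riesz_variation (R : realType) (q : R) (g : R -> R) : \bar R :=
  ereal_sup
    [set ((\sum_(n < (size s).-1)
             `|g s`_n.+1 - g s`_n| `^ q / `|s`_n.+1 - s`_n| `^ (q - 1))
          `^ q^-1)%:E
    | s in [set s : seq R | sorted <%R s]].

(* Absolute continuity on the whole line (not merely on compact intervals):
   delta does not depend on the location of the intervals. *)
Definition abs_continuous (R : realType) (g : R -> R) : Prop :=
  forall e : R, 0 < e -> exists2 d : R, 0 < d &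
    forall (n : nat) (a b : 'I_n -> R),
      (forall i, a i < b i) ->
      trivIset setT (fun i => [set` `]a i, b i[]) ->
      \sum_(i < n) (b i - a i) < d ->
      \sum_(i < n) `|g (b i) - g (a i)| < e.

(* Main.v *)
Require Import Defs.
From HB Require Import structures.
From mathcomp Require Import all_boot all_order all_algebra.
From mathcomp Require Import all_classical all_reals all_analysis.
From mathcomp Require Import measurable_realfun ring lra.
Import Order.TTheory GRing.Theory Num.Theory.
Import numFieldNormedType.Exports.
Local Open Scope classical_set_scope.
Local Open Scope ring_scope.

(** Write [A I] for |I|^(beta - 1) times the integral of |f| over [I], and [M] for
    the maximal function. If [x < y] and [M x > M y], an almost optimal interval [I]
    for [x] ends before [y], and translating [I] until it reaches [y] gives
    M x - M y <= |I|^(beta - 1) (y - x) Var f. As (1 - beta)(q - 1) = beta, this yields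
    |M x - M y|^q / (y - x)^(q - 1) <= (M x - M y) |I|^(- beta) (Var f)^(q - 1).
    The decreasing steps of a partition are grouped into runs along which |I| does not
    shrink, so that the sum over a run telescopes; extending [I] up to [y] then bounds
    |I|^(- beta) (M x - M y) by the difference of the averages of |f| over [I] and over
    the gap between [I] and [y]. Each point of the line is used by at most two runs.

    Absolute continuity follows from the bound on the [q]-variation when [q > 1]. When
    [q = 1], the decrease of [M] is controlled by that of the left-sided maximal
    function, whose running minimum from any point [p] is Lipschitz away from [p].

    Finally, an absolutely continuous function defines a signed measure dominated by
    the Lebesgue measure; its Radon-Nikodym density is the derivative almost everywhere,
    and the equality of the norm with the [q]-variation comes from Fatou's lemma for
    the difference quotients along a grid and from convexity of t^q. *)

Set Implicit Arguments.
Unset Strict Implicit.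
Unset Printing Implicit Defensive.

(** * Averages over intervals *)

(** By concavity of t^a: [k + u] and [k + v] are convex combinations of [k] and [k + u + v] with
    exchanged weights, so the two concavity inequalities add up to the claim. *)
Lemma powR_concave_exchange (R : realType) (a k u v : R) :
  0 < a <= 1 -> 0 <= k -> 0 <= u -> 0 <= v ->
  k `^ a + (k + u + v) `^ a <= (k + u) `^ a + (k + v) `^ a.
Proof.
move=> /andP[a0 a1] k0 u0 v0.
have aN0 : a != 0 by rewrite gt_eqF.
have q1 : 1 <= a^-1 by rewrite invf_ge1.
(* Concavity of t^a is read off from the convexity of t^(1/a) at the points k^a and (k + u +
   v)^a. *)
have key (t : R) : 0 <= t -> t <= 1 ->
    t * k `^ a + (1 - t) * (k + u + v) `^ a <= (t * k + (1 - t) * (k + u + v)) `^ a.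
  move=> t0 t1.
  have cvx := @convex_powR R a^-1 q1 (Itv01 t0 t1) (k `^ a) ((k + u + v) `^ a).
  have := cvx; rewrite !inE /= !in_itv /= !andbT => /(_ (powR_ge0 _ _) (powR_ge0 _ _)).
  rewrite !convRE /= -!powRrM !mulfV// !powRr1 ?addr_ge0// => h.
  set lhs := t * k `^ a + (1 - t) * (k + u + v) `^ a.
  have {}h : lhs `^ a^-1 <= t * k + (1 - t) * (k + u + v) by exact: h.
  have lhs0 : 0 <= lhs by apply: addr_ge0; apply: mulr_ge0; rewrite ?powR_ge0 ?subr_ge0.
  have -> : lhs = (lhs `^ a^-1) `^ a by rewrite -powRrM mulVf// powRr1.
  apply: ge0_ler_powR => //; rewrite ?nnegrE ?powR_ge0 ?(ltW a0)//.
  by apply: addr_ge0; apply: mulr_ge0; lra.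
have [uv0|uv0] := leP (u + v) 0.
  have [-> ->] : u = 0 /\ v = 0 by split; lra.
  by rewrite !addr0.
have h1 := key (v / (u + v)); have h2 := key (u / (u + v)).
have e1 : v / (u + v) * k + (1 - v / (u + v)) * (k + u + v) = k + u by field; lra.
have e2 : u / (u + v) * k + (1 - u / (u + v)) * (k + u + v) = k + v by field; lra.
have bnd w : 0 <= w -> w <= u + v -> 0 <= w / (u + v) /\ w / (u + v) <= 1.
  by move=> w0 wuv; split; [rewrite divr_ge0// ltW|rewrite ler_pdivrMr// mul1r].
have [b1 b2] := bnd v v0 (ltac:(lra)); have [b3 b4] := bnd u u0 (ltac:(lra)).
have {h1} := h1 b1 b2; have {h2} := h2 b3 b4; rewrite e1 e2.
have -> : u / (u + v) = 1 - v / (u + v) by field; lra.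
by move=> *; lra.
Qed.

(* What the argument uses of a function [f] of bounded variation: [J c d] is the
   integral of |f| over [c, d], [T] the variation of [f] up to a point, [V] its total
   variation, and [F] the maximal function, assumed finite. This class is stable under
   reflection of the line, which exchanges increasing and decreasing steps. *)
Record fmax_data (R : realType) (beta V : R) (J : R -> R -> R) (T F : R -> R) : Prop :=
  FmaxData {
  fmax_beta_ge0 : 0 <= beta ;
  fmax_beta_lt1 : beta < 1 ;
  fmax_J_ge0 : forall c d : R, c <= d -> 0 <= J c d ;
  fmax_J_add : forall c d e : R, c <= d -> d <= e -> J c e = J c d + J d e ;
  fmax_T_nd : forall x y : R, x <= y -> T x <= T y ;
  fmax_T_ge0 : forall x : R, 0 <= T x ;
  fmax_T_le : forall x : R, T x <= V ;
  fmax_osc : forall c d e f : R, c < d -> d <= e -> e < f ->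
    `|J c d / (d - c) - J e f / (f - e)| <= T f - T c ;
  fmax_ub : forall x c d : R, c <= x -> x <= d -> c < d ->
    J c d / (d - c) `^ (1 - beta) <= F x ;
  fmax_approx : forall x e : R, 0 < e -> exists c d : R,
    [/\ c <= x, x <= d, c < d & F x - e < J c d / (d - c) `^ (1 - beta)] }.

(** Reflection turns the variation up to a point into the variation beyond it, hence
    [V - T (- z)]. *)
Lemma fmax_data_opp (R : realType) (beta V : R) J T F :
  @fmax_data R beta V J T F ->
  fmax_data beta V (fun c d => J (- d) (- c)) (fun z => V - T (- z)) (fun x => F (- x)).
Proof.
case=> b0 b1 J0 JD Tnd T0 TV osc ub app; split => //.
- by move=> c d cd; apply: J0; rewrite lerN2.
- by move=> c d e cd de; rewrite addrC; apply: JD; rewrite lerN2.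
- by move=> x y xy; rewrite lerD2l lerN2 Tnd// lerN2.
- by move=> x; rewrite subr_ge0.
- by move=> x; rewrite gerBl.
- move=> c d e f cd de ef; have := osc (- f) (- e) (- d) (- c).
  rewrite !ltrN2 lerN2 distrC => /(_ ef de cd).
  have -> : - c - - d = d - c by ring.
  have -> : - e - - f = f - e by ring.
  by move=> h; lra.
- move=> x c d cx xd cd; have := ub (- x) (- d) (- c).
  rewrite !lerN2 ltrN2 => /(_ xd cx cd).
  by rewrite opprK (addrC (- c)).
- move=> x e e0; have [c [d [cx xd cd h]]] := app (- x) e e0.
  exists (- d), (- c); rewrite !opprK; split; rewrite ?ltrN2//; [lra|lra|].
  by rewrite (addrC (- c)).
Qed.

Section fmax_basic.
Variables (R : realType) (beta V : R) (J : R -> R -> R) (T F : R -> R).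
Hypothesis FD : fmax_data beta V J T F.
Local Notation alpha := (1 - beta).
Local Notation A c d := (J c d / (d - c) `^ (1 - beta)).

Lemma fmax_JX x : J x x = 0.
Proof. by have := fmax_J_add FD (lexx x) (lexx x) => h; lra. Qed.

Lemma fmax_alpha : 0 < alpha <= 1.
Proof. have := fmax_beta_ge0 FD; have := fmax_beta_lt1 FD. lra. Qed.

Lemma fmax_V_ge0 : 0 <= V.
Proof. exact: le_trans (fmax_T_ge0 FD 0) (fmax_T_le FD 0). Qed.

(** If [c, d] overlaps its translate ending at [y], the common part cancels and two pieces of length
    [y - d] remain; otherwise the two intervals themselves are compared, of length at most [y - d].
    In both cases the averages differ by at most [V]. *)
Lemma fmax_J_shift c d y : c < d -> d < y ->
  J c d - J (c + (y - d)) y <= (y - d) * V.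
Proof.
move=> cd dy; have [_ _ J0 JD Tnd T0 TV osc _ _] := FD.
have TB x z : T x - T z <= V by have := T0 z; have := TV x; lra.
have yd0 : 0 < y - d by rewrite subr_gt0.
have [tL|Lt] := leP (y - d) (d - c).
- have cc : c < c + (y - d) by rewrite ltrDl.
  have ccd : c + (y - d) <= d by lra.
  have e1 := JD _ _ _ (ltW cc) ccd.
  have e2 := JD _ _ _ ccd (ltW dy).
  have := osc _ _ _ _ cc ccd dy.
  have -> : c + (y - d) - c = y - d by ring.
  move=> /(le_trans (ler_norm _)) h.
  have : (J c (c + (y - d)) - J d y) / (y - d) <= V.
    by rewrite mulrBl; apply: le_trans h _; exact: TB.
  by rewrite ler_pdivrMr// e1 e2; lra.
- have ->: c + (y - d) = y - (d - c) by ring.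
  have L0 : 0 < d - c by rewrite subr_gt0.
  have := osc c d (y - (d - c)) y cd (ltac:(lra)) (ltac:(lra)).
  have -> : y - (y - (d - c)) = d - c by ring.
  move=> /(le_trans (ler_norm _)) h.
  have : (J c d - J (y - (d - c)) y) / (d - c) <= V.
    by rewrite mulrBl; apply: le_trans h _; exact: TB.
  rewrite ler_pdivrMr// => h2; apply: le_trans h2 _; rewrite mulrC.
  by apply: ler_wpM2r; [exact: fmax_V_ge0|exact: ltW].
Qed.

Lemma fmax_shift c d y : c < d -> d < y ->
  A c d - F y <= (y - d) * V / (d - c) `^ alpha.
Proof.
move=> cd dy; have [_ _ _ _ _ _ _ _ ub _] := FD.
have cy : c + (y - d) < y by lra.
have := ub y _ y (ltW cy) (lexx _) cy; rewrite (_ : y - (c + (y - d)) = d - c); last by ring.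
move=> Fy; apply: (@le_trans _ _ ((J c d - J (c + (y - d)) y) / (d - c) `^ alpha)).
  by rewrite mulrBl lerD2l lerN2.
by rewrite ler_pM2r ?invr_gt0 ?powR_gt0 ?subr_gt0// fmax_J_shift.
Qed.

(** The value [F y] is bounded below through [c, y], the extension of [c, d] up to [y]. After
    rescaling, this compares the plain averages over [c, d] and [d, y]. *)
Lemma fmax_drop_osc c d y : c < d -> d < y -> F y <= A c d ->
  (d - c) `^ alpha / (d - c) * (A c d - F y) <= T y - T c.
Proof.
move=> cd dy FyA; have [_ _ J0 JD Tnd T0 TV osc ub _] := FD.
have L0 : 0 < d - c by lra.
have L1 : 0 < y - c by lra.
have P0 : 0 < (d - c) `^ alpha by exact: powR_gt0.
have P1 : 0 < (y - c) `^ alpha by exact: powR_gt0.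
have Fy := ub y c y (ltac:(lra)) (lexx _) (ltac:(lra)).
have e1 := JD c d y (ltac:(lra)) (ltac:(lra)).
have := osc c d d y cd (lexx _) dy.
move=> /(le_trans (ler_norm _)) h; apply: le_trans _ h.
(* The ratio of lengths is at most 1 and [alpha <= 1], so its power [alpha] is larger; this replaces
   the normalised integral over [c, y] by the plain average. *)
have ratio : (d - c) / (y - c) <= (d - c) `^ alpha / (y - c) `^ alpha.
  have -> : (d - c) `^ alpha / (y - c) `^ alpha = ((d - c) / (y - c)) `^ alpha.
    rewrite powRM ?invr_ge0 ?(ltW L0) ?(ltW L1)//; congr (_ * _).
    by rewrite -(powR_inv1 (ltW L1)) -powRrM mulN1r powRN.
  apply: ger1_powR; last by case/andP: fmax_alpha.
  by rewrite divr_gt0//= ler_pdivrMr//; lra.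
have Jcd0 := J0 c d (ltW cd); have Jdy0 := J0 d y (ltW dy).
have Jcy0 := J0 c y (ltac:(lra)).
have k1 : (d - c) `^ alpha / (d - c) * (A c d - F y) <=
    J c d / (d - c) - (d - c) `^ alpha / (y - c) `^ alpha * (J c y / (d - c)).
  have : (d - c) `^ alpha / (d - c) * (A c d - F y) <=
         (d - c) `^ alpha / (d - c) * (A c d - J c y / (y - c) `^ alpha).
    by apply: ler_wpM2l; [rewrite divr_ge0// ltW|lra].
  move/le_trans; apply; rewrite le_eqVlt; apply/orP; left; apply/eqP; field.
  by rewrite !gt_eqF.
have k2 : (d - c) / (y - c) * (J c y / (d - c)) <=
    (d - c) `^ alpha / (y - c) `^ alpha * (J c y / (d - c)).
  by apply: ler_wpM2r => //; rewrite divr_ge0// ltW.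
have e3 : (d - c) / (y - c) * (J c y / (d - c)) = J c y / (y - c).
  by field; rewrite !gt_eqF.
have e4 : J c d / (d - c) - J c y / (y - c) =
    (y - d) / (y - c) * (J c d / (d - c) - J d y / (y - d)).
  by rewrite e1; field; rewrite !gt_eqF//; lra.
have k3 : J c d / (d - c) - J c y / (y - c) >= 0.
  have : 0 <= (d - c) `^ alpha / (d - c) * (A c d - F y).
    by rewrite mulr_ge0 ?divr_ge0 ?(ltW P0) ?(ltW L0)// subr_ge0.
  by lra.
have w0 : 0 < (y - d) / (y - c) by rewrite divr_gt0//; lra.
have w1 : (y - d) / (y - c) <= 1 by rewrite ler_pdivrMr//; lra.
move: k3; rewrite e4 pmulr_rge0// => k3.
apply: le_trans k1 _; rewrite -e3 in e4.
apply: (@le_trans _ _ ((y - d) / (y - c) * (J c d / (d - c) - J d y / (y - d)))); first by lra.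
exact: ler_piMl.
Qed.

(** When [c < c1], the integrals over the union [c, d1] and the intersection [c1, d] add up to those
    over the two intervals. The intersection contains [x], so near-optimality of [c, d] keeps its
    integral small, and concavity of t^alpha leaves enough for the union. *)
Lemma fmax_union c d x c1 d1 e : 0 <= e -> c <= x -> x <= d -> c < d -> c1 <= x -> d <= d1 ->
  c1 < d1 -> F x - e <= A c d -> A c1 d1 <= A c d ->
  exists c', [/\ c' <= c, c' <= c1 & A c1 d1 - e <= A c' d1].
Proof.
move=> e0 cx xd cd c1x dd1 cd1 Fx AA; have [_ _ J0 JD _ _ _ _ ub _] := FD.
have [cc|cc] := leP c1 c; first by exists c1; split=> //; rewrite gerBl.
exists c; split => //; first exact: ltW.
have L0 : 0 < d - c by lra.
have L1 : 0 < d1 - c1 by lra.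
have U0 : 0 < d1 - c by lra.
have P0 : 0 < (d - c) `^ alpha by exact: powR_gt0.
have P1 : 0 < (d1 - c1) `^ alpha by exact: powR_gt0.
have PU : 0 < (d1 - c) `^ alpha by exact: powR_gt0.
have [al0 al1] := andP fmax_alpha.
have e1 := JD c c1 d1 (ltac:(lra)) (ltac:(lra)).
have e2 := JD c c1 d (ltac:(lra)) (ltac:(lra)).
have k0 : 0 <= (d - c1) `^ alpha by exact: powR_ge0.
(* [F x] bounds the normalised integral over the intersection; if the latter is a single point, both
   sides vanish. *)
have hk : J c1 d <= (A c d + e) * (d - c1) `^ alpha.
  have [c1d|c1d] := ltP c1 d.
    have Pk : 0 < (d - c1) `^ alpha by apply: powR_gt0; lra.
    by rewrite -ler_pdivrMr//; have := ub x c1 d c1x xd c1d; lra.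
  have -> : c1 = d by lra.
  by rewrite fmax_JX subrr powR0 ?mulr0// gt_eqF.
have conc := @powR_concave_exchange R alpha (d - c1) (c1 - c) (d1 - d) fmax_alpha
  (ltac:(lra)) (ltac:(lra)) (ltac:(lra)).
rewrite (_ : d - c1 + (c1 - c) = d - c) in conc; last by ring.
rewrite (_ : d - c + (d1 - d) = d1 - c) in conc; last by ring.
rewrite (_ : d - c1 + (d1 - d) = d1 - c1) in conc; last by ring.
rewrite ler_pdivlMr//.
have E0 : J c d = A c d * (d - c) `^ alpha by rewrite divfK// gt_eqF.
have E1 : J c1 d1 = A c1 d1 * (d1 - c1) `^ alpha by rewrite divfK// gt_eqF.
have A10 : 0 <= A c1 d1 by rewrite divr_ge0// ?(ltW P1)// J0// ltW.
set a := A c d in AA E0 hk *; set a1 := A c1 d1 in AA E1 A10 *.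
set pU := (d1 - c) `^ alpha in PU conc *; set p0 := (d - c) `^ alpha in P0 conc E0.
set p1 := (d1 - c1) `^ alpha in P1 conc E1; set pk := (d - c1) `^ alpha in k0 conc hk.
have pk0 : pk <= p0 by apply: ge0_ler_powR; rewrite ?nnegrE; lra.
have pkU : pk <= pU by apply: ge0_ler_powR; rewrite ?nnegrE; lra.
(* Since [a1 <= a] and [pk <= p0], the term a (p0 - pk) is at least a1 (p0 - pk), and concavity
   gives p0 + p1 - pk >= pU. The error is e pk <= e pU. *)
have : J c d1 = J c d + J c1 d1 - J c1 d by lra.
move=> ->; rewrite E0 E1; nra.
Qed.

End fmax_basic.

(** * The Riesz variation along chains of intervals *)

(** Gaps between consecutive intervals are allowed, so that selecting some steps of a partition
    leaves a chain. *)
Fixpoint itv_chain (R : realType) (z : R) (s : seq (R * R)) : bool :=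
  if s is p :: s' then [&& z <= p.1, p.1 < p.2 & itv_chain p.2 s'] else true.

Definition riesz_term (R : realType) (q : R) (F : R -> R) (p : R * R) : R :=
  `|F p.2 - F p.1| `^ q / (p.2 - p.1) `^ (q - 1).

Lemma itv_chain_le (R : realType) (z z' : R) s :
  z' <= z -> itv_chain z s -> itv_chain z' s.
Proof. by case: s => // p s zz /= /andP[/(le_trans zz) -> ->]. Qed.

Lemma itv_chain_filter (R : realType) (P : pred (R * R)) (z : R) s :
  itv_chain z s -> itv_chain z [seq p <- s | P p].
Proof.
elim: s z => // p s IH z /= /and3P[zp pp cs].
case: (P p) => /=; first by rewrite zp pp IH.
by apply: IH; apply: itv_chain_le cs; exact: le_trans zp (ltW pp).
Qed.

(** One factor [D] is kept and the remaining power [q - 1] is bounded by D <= h V / (th L^a). As q a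
    = 1, the power L^(- a (q - 1)) equals L^a / L; the kept factor is then absorbed by
    [th * D <= B]. *)
Lemma riesz_term_le (R : realType) (a q th V D B h L L' : R) :
  0 < a <= 1 -> q * a = 1 -> 0 < th -> 0 <= V -> 0 < D -> 0 < h ->
  0 < L -> L <= L' -> th * D <= B -> B <= h * V / L' `^ a ->
  D `^ q / h `^ (q - 1) <= th `^ (- q) * V `^ (q - 1) * (L `^ a / L) * B.
Proof.
move=> /andP[a0 a1] qa th0 V0 D0 h0 L0 LL DB Bh.
have q1 : 1 <= q by nra.
have La0 : 0 < L `^ a by exact: powR_gt0.
have La'0 : 0 < L' `^ a by apply: powR_gt0; lra.
set M := V / (th * L `^ a).
have M0 : 0 <= M by rewrite divr_ge0// ltW// mulr_gt0.
have DM : D <= h * M.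
  have h1 : th * D <= h * V / L `^ a.
    apply: (le_trans DB); apply: (le_trans Bh); rewrite ler_wpM2l ?mulr_ge0 ?(ltW h0)//.
    by rewrite lef_pV2 ?posrE//; apply: ge0_ler_powR; rewrite ?nnegrE; lra.
  rewrite -(ler_pM2l th0); apply: (le_trans h1).
  rewrite le_eqVlt; apply/orP; left; apply/eqP; rewrite /M; field.
  by rewrite !gt_eqF.
have Dq : D `^ (q - 1) <= h `^ (q - 1) * M `^ (q - 1).
  have h0' := ltW h0; have D0' := ltW D0.
  have q0 : 0 <= q - 1 by rewrite subr_ge0.
  have hM0 : 0 <= h * M by exact: mulr_ge0.
  by rewrite -powRM//; apply: ge0_ler_powR.
have hq0 : 0 < h `^ (q - 1) by exact: powR_gt0.
have step1 : D `^ q / h `^ (q - 1) <= D * M `^ (q - 1).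
  have <- : D * D `^ (q - 1) = D `^ q by rewrite mulr_powRB1 ?(ltW D0)//; lra.
  rewrite ler_pdivrMr// -mulrA; apply: ler_wpM2l; first exact: ltW.
  by rewrite mulrC.
have eM : M `^ (q - 1) = V `^ (q - 1) * th `^ (- (q - 1)) * (L `^ a / L).
  have th0' := ltW th0; have La0' := ltW La0.
  have thL0 : 0 <= th * L `^ a by exact: mulr_ge0.
  rewrite /M powRM ?invr_ge0// -[(th * _)^-1]powR_inv1//.
  rewrite -powRrM mulN1r powRM// -mulrA; congr (_ * (_ * _)).
  rewrite -powRrM (_ : a * - (q - 1) = a - 1); last by rewrite mulrN mulrBr mulr1 mulrC qa; ring.
  have LN0 : L != 0 by rewrite gt_eqF.
  by rewrite powRB ?LN0 ?implybT// powRr1// ltW.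
apply: (le_trans step1); rewrite eM.
have -> : th `^ (- (q - 1)) = th `^ (- q) * th.
  rewrite opprB addrC powRD; last by rewrite (gt_eqF th0) implybT.
  by rewrite powRr1// ltW.
set C := V `^ (q - 1) * th `^ (- q) * (L `^ a / L).
have C0 : 0 <= C by rewrite !mulr_ge0 ?powR_ge0 ?invr_ge0 ?(ltW L0).
have -> : D * (V `^ (q - 1) * (th `^ (- q) * th) * (L `^ a / L)) = C * (th * D).
  by rewrite /C; ring.
have -> : th `^ (- q) * V `^ (q - 1) * (L `^ a / L) * B = C * B by rewrite /C; ring.
exact: ler_wpM2l.
Qed.

Section fmax_runs.
Variables (R : realType) (beta V : R) (J : R -> R -> R) (T F : R -> R) (q : R).
Hypothesis FD : fmax_data beta V J T F.
Hypothesis qE : q * (1 - beta) = 1.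
Local Notation alpha := (1 - beta).
Local Notation A c d := (J c d / (d - c) `^ (1 - beta)).

(* Induction on the remaining steps [s]: [c, d] is an almost optimal interval for the
   first point [x] of the current run, and [y0] is the right end of the last step. The
   next step, with almost optimal interval [c1, d1], continues the run if [c1 <= x]
   (the union with [c, d] is then almost optimal too, hence not shorter) and opens a new
   run otherwise. The two terms on the right account for two runs being able to overlap. *)
Lemma fmax_run (th e : R) s : 0 < th -> 0 < e ->
  (forall p, p \in s -> F p.2 < F p.1 /\ 2 * e <= (1 - th) * (F p.1 - F p.2)) ->
  forall c d x y0, c <= x -> x <= d -> c < d -> d < y0 -> F x - e <= A c d ->
    F y0 <= A c d -> itv_chain y0 s ->
  \sum_(p <- s) riesz_term q F p +
    th `^ (- q) * V `^ (q - 1) * ((d - c) `^ alpha / (d - c)) * (A c d - F y0) <=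
  th `^ (- q) * V `^ (q - 1) * ((V - T c) + (V - T x)).
Proof.
move=> th0 e0.
have [_ _ J0 JD Tnd T0 TV _ ub app] := FD.
have V0 := fmax_V_ge0 FD.
have al := fmax_alpha FD.
set C := th `^ (- q) * V `^ (q - 1).
have C0 : 0 <= C by rewrite mulr_ge0 ?powR_ge0.
elim: s => [|[x1 y1] s IH] hs c d x y0 cx xd cd dy Fx Fy.
  move=> _; rewrite big_nil add0r -mulrA.
  have h := fmax_drop_osc FD cd dy Fy.
  apply: ler_wpM2l => //; apply: (le_trans h).
  by have := TV y0; have := TV x; lra.
move=> /= /and3P[y0x1 xy1 ch]; rewrite big_cons.
have [/= FF eD] := hs _ (mem_head _ _).
have {}IH := IH (fun p ps => hs p (ltac:(by rewrite inE ps orbT))).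
have [c1 [d1 [c1x1 x1d1 cd1 A1]]] := app x1 e e0.
set D := F x1 - F y1 in eD.
have D0 : 0 < D by rewrite subr_gt0.
have eD1 : e < D by clear -e0 D0 eD th0; nra.
have c1y1 : c1 <= y1 := le_trans c1x1 (ltW xy1).
have A1y1 : F y1 < A c1 d1.
  by apply: lt_trans A1; rewrite -subr_gt0 addrAC subr_gt0.
(* An interval reaching [y1] would be admissible there and force [A c1 d1 <= F y1]. *)
have d1y1 : d1 < y1.
  by rewrite ltNge; apply/negP => /(ub y1 c1 d1 c1y1) /(_ cd1); rewrite leNgt A1y1.
have c1d1y1 : c1 < y1 := lt_trans cd1 d1y1.
have yx1 : 0 < y1 - x1 by rewrite subr_gt0.
have yd1 : y1 - d1 <= y1 - x1 by rewrite lerD2l lerN2.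
have tE : riesz_term q F (x1, y1) = D `^ q / (y1 - x1) `^ (q - 1).
  by rewrite /riesz_term /= distrC ger0_norm// ltW.
have L0 : 0 < d - c by rewrite subr_gt0.
have [c1x|xc1] := leP c1 x.
(* The run continues: [c1, d1] contains [y0], hence [A c1 d1 <= F y0], and the step costs at most a
   fixed multiple of [F y0 - F y1], which telescopes. *)
- have c1y0 : c1 <= y0 := le_trans c1x (le_trans xd (ltW dy)).
  have y0d1 : y0 <= d1 := le_trans y0x1 x1d1.
  have Ay0 : A c1 d1 <= F y0 by apply: ub.
  have [c' [c'c c'c1 A']] := fmax_union FD (ltW e0) cx xd cd c1x
    (le_trans (ltW dy) y0d1) cd1 Fx (le_trans Ay0 Fy).
  have c'd1 : c' < d1 := le_lt_trans c'c1 cd1.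
  have A'y0 : A c' d1 <= F y0 by apply: ub => //; exact: le_trans c'c1 c1y0.
  have sh := fmax_shift FD c'd1 d1y1.
  have sh' : A c' d1 - F y1 <= (y1 - x1) * V / (d1 - c') `^ alpha.
    apply: (le_trans sh); rewrite -!mulrA; apply: ler_wpM2r => //.
    by rewrite divr_ge0 ?powR_ge0.
  have LL : d - c <= d1 - c'.
    by apply: lerB => //; exact: le_trans (ltW dy) y0d1.
  (* Two errors [e] are lost, one in the choice of [c1, d1] and one in passing to the union; hence
     the [2 * e] in the hypothesis. *)
  have thD : th * D <= A c' d1 - F y1.
    by move: eD A' (ltW A1); rewrite /D; clear; move: (A _ _) (A _ _) => *; lra.
  have tm := @riesz_term_le _ _ _ th V D _ (y1 - x1) (d - c) (d1 - c') al qE th0 V0 D0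
    yx1 L0 LL thD sh'.
  have dy1 : d < y1 := lt_trans (lt_le_trans dy y0x1) xy1.
  have Fy1 : F y1 <= A c d by apply: le_trans (ltW A1y1) (le_trans Ay0 Fy).
  have h := IH c d x y1 cx xd cd dy1 Fx Fy1 ch.
  rewrite -/C in tm; rewrite tE; apply: le_trans h.
  set w := (d - c) `^ alpha / (d - c) in tm *.
  have w0 : 0 <= w by rewrite divr_ge0 ?powR_ge0 ?(ltW L0).
  have {}tm : D `^ q / (y1 - x1) `^ (q - 1) <= C * w * (F y0 - F y1).
    by apply: le_trans tm _; apply: ler_wpM2l; [exact: mulr_ge0|rewrite lerD2r].
  rewrite -addrA; apply: le_trans (lerD tm (lexx _)) _.
  by rewrite le_eqVlt; apply/orP; left; apply/eqP; ring.
(* A new run opens: the old one is paid by [T y0 - T c], and since [x < c1] and [y0 <= x1], the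
   bound for the new run leaves room for this. *)
- have L1 : 0 < d1 - c1 by rewrite subr_gt0.
  have sh := fmax_shift FD cd1 d1y1.
  have sh' : A c1 d1 - F y1 <= (y1 - x1) * V / (d1 - c1) `^ alpha.
    apply: (le_trans sh); rewrite -!mulrA; apply: ler_wpM2r => //.
    by rewrite divr_ge0 ?powR_ge0.
  have thD : th * D <= A c1 d1 - F y1.
  by move: eD (ltW A1) (ltW e0); rewrite /D; clear; move: (A _ _) => *; lra.
  have tm := @riesz_term_le _ _ _ th V D _ (y1 - x1) (d1 - c1) (d1 - c1) al qE th0 V0 D0
    yx1 L1 (lexx _) thD sh'.
  have h := IH c1 d1 x1 y1 c1x1 x1d1 cd1 d1y1 (ltW A1) (ltW A1y1) ch.
  have h2 := fmax_drop_osc FD cd dy Fy.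
  have {}h2 := ler_wpM2l C0 h2.
  have k1 : C * T x <= C * T c1 by rewrite ler_wpM2l// Tnd// ltW.
  have k2 : C * T y0 <= C * T x1 by rewrite ler_wpM2l// Tnd.
  rewrite mulrA in h2; rewrite -/C in tm h; rewrite tE.
  apply: le_trans (lerD (lerD tm (lexx _)) h2) _.
  rewrite [_ * _ + \sum_(_ <- _) _]addrC; apply: le_trans (lerD h (lexx _)) _.
  by rewrite !mulrDr !mulrN; move: k1 k2; clear; lra.
Qed.

Lemma fmax_dec_sum z s : itv_chain z s -> (forall p, p \in s -> F p.2 < F p.1) ->
  \sum_(p <- s) riesz_term q F p <= 4 * V `^ q.
Proof.
have [_ _ J0 JD Tnd T0 TV _ ub app] := FD.
have V0 := fmax_V_ge0 FD.
have al := fmax_alpha FD.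
have q1 : 1 <= q by case/andP: al; have := qE; nra.
move=> ch hs.
have Vq0 : 0 <= V `^ q by exact: powR_ge0.
(* This makes th^(-q) = 2; the two possibly overlapping runs give the other factor 2 of the constant
   4. *)
set th : R := 2 `^ (- q^-1).
have th0 : 0 < th by apply: powR_gt0; lra.
have th1 : th < 1.
  rewrite /th powRN invf_lt1 ?powR_gt0//.
  rewrite -[ltLHS](powRr0 (2 : R)) /powR gt_eqF// ltr_expR.
  by rewrite ltr_pM2r ?ln_gt0 ?invr_gt0; lra.
have thq : th `^ (- q) = 2.
  by rewrite /th -powRrM mulrNN mulVf ?powRr1//; lra.
(* There are finitely many steps, all strictly decreasing, so one error [e] serves them all. *)
have [e e0 he] : exists2 e : R, 0 < e &
    forall p, p \in s -> 2 * e <= (1 - th) * (F p.1 - F p.2).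
  elim: s hs {ch} => [|p s IH] hs; first by exists 1.
  have [e e0 he] := IH (fun p ps => hs p (ltac:(by rewrite inE ps orbT))).
  have Fp := hs _ (mem_head _ _).
  have m0 : 0 < (1 - th) * (F p.1 - F p.2) / 2.
    by rewrite divr_gt0// mulr_gt0 ?subr_gt0.
  exists (Num.min e ((1 - th) * (F p.1 - F p.2) / 2)); first by rewrite lt_min e0.
  move=> r; rewrite inE => /orP[/eqP ->|rs].
    have : Num.min e ((1 - th) * (F p.1 - F p.2) / 2) <= (1 - th) * (F p.1 - F p.2) / 2.
      by rewrite ge_min lexx orbT.
    by lra.
  have : Num.min e ((1 - th) * (F p.1 - F p.2) / 2) <= e by rewrite ge_min lexx.
  by have := he r rs; lra.
(* The first step opens the first run; it is bounded directly because the induction needs a run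
   already open. *)
case: s ch hs he => [|[x1 y1] s] ch hs he.
  by rewrite big_nil mulr_ge0.
move: ch => /= /and3P[zx xy1 ch].
have /= FF := hs _ (mem_head _ _); have /= eD := he _ (mem_head _ _).
have [c1 [d1 [c1x1 x1d1 cd1 A1]]] := app x1 e e0.
rewrite big_cons.
set D := F x1 - F y1 in eD.
have D0 : 0 < D by rewrite subr_gt0.
have eD1 : e < D by clear -e0 D0 eD th0; nra.
have c1y1 : c1 <= y1 := le_trans c1x1 (ltW xy1).
have A1y1 : F y1 < A c1 d1.
  by apply: lt_trans A1; rewrite -subr_gt0 addrAC subr_gt0.
have d1y1 : d1 < y1.
  by rewrite ltNge; apply/negP => /(ub y1 c1 d1 c1y1) /(_ cd1); rewrite leNgt A1y1.
have c1d1y1 : c1 < y1 := lt_trans cd1 d1y1.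
have yx1 : 0 < y1 - x1 by rewrite subr_gt0.
have yd1 : y1 - d1 <= y1 - x1 by rewrite lerD2l lerN2.
have tE : riesz_term q F (x1, y1) = D `^ q / (y1 - x1) `^ (q - 1).
  by rewrite /riesz_term /= distrC ger0_norm// ltW.
have L1 : 0 < d1 - c1 by rewrite subr_gt0.
have sh := fmax_shift FD cd1 d1y1.
have sh' : A c1 d1 - F y1 <= (y1 - x1) * V / (d1 - c1) `^ alpha.
  apply: (le_trans sh); rewrite -!mulrA; apply: ler_wpM2r => //.
  by rewrite divr_ge0 ?powR_ge0.
have thD : th * D <= A c1 d1 - F y1.
  by move: eD (ltW A1) (ltW e0); rewrite /D; clear; move: (A _ _) => *; lra.
have tm := @riesz_term_le _ _ _ th V D _ (y1 - x1) (d1 - c1) (d1 - c1) al qE th0 V0 D0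
  yx1 L1 (lexx _) thD sh'.
have hs' p : p \in s -> F p.2 < F p.1 /\ 2 * e <= (1 - th) * (F p.1 - F p.2).
  by move=> ps; split; [apply: hs|apply: he]; rewrite inE ps orbT.
have h := fmax_run th0 e0 hs' c1x1 x1d1 cd1 d1y1 (ltW A1) (ltW A1y1) ch.
rewrite tE; apply: (le_trans (lerD tm (lexx _))); rewrite addrC; apply: (le_trans h).
have <- : V * V `^ (q - 1) = V `^ q by rewrite mulr_powRB1//; lra.
rewrite thq -!mulrA [_ * (_ + _)]mulrC.
have -> : 4 * (V * V `^ (q - 1)) = 2 * ((V + V) * V `^ (q - 1)) by ring.
rewrite ler_pM2l// ler_wpM2r ?powR_ge0//.
by have := T0 c1; have := T0 x1; lra.
Qed.

End fmax_runs.

Lemma itv_chain_mem (R : realType) (z : R) s p :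
  itv_chain z s -> p \in s -> z <= p.1 /\ p.1 < p.2.
Proof.
elim: s z => // r s IH z /= /and3P[zr rr cs]; rewrite inE => /orP[/eqP ->//|ps].
by have [h1 h2] := IH _ cs ps; split=> //; lra.
Qed.

Lemma itv_chain_rcons (R : realType) (z : R) s p :
  itv_chain z s -> (forall r, r \in s -> r.2 <= p.1) -> z <= p.1 -> p.1 < p.2 ->
  itv_chain z (rcons s p).
Proof.
elim: s z => /= [z _ _ -> ->//|r s IH z /and3P[-> -> cs] hs zp pp] /=.
apply: IH => //; last by apply: hs; exact: mem_head.
by move=> u us; apply: hs; rewrite inE us orbT.
Qed.

Definition itv_opp (R : realType) (p : R * R) : R * R := (- p.2, - p.1).

Lemma itv_chain_rev (R : realType) (z w : R) s :
  itv_chain z s -> (forall p, p \in s -> p.2 <= w) ->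
  itv_chain (- w) (map (@itv_opp R) (rev s)).
Proof.
elim: s z => //= p s IH z /and3P[zp pp cs] hs; rewrite rev_cons map_rcons.
apply: itv_chain_rcons => /=.
- by apply: IH cs _ => r rs; apply: hs; rewrite inE rs orbT.
- move=> _ /mapP[r + ->] /=; rewrite mem_rev => rs; rewrite lerN2.
  by have [] := itv_chain_mem cs rs.
- by rewrite lerN2 hs// mem_head.
- by rewrite ltrN2.
Qed.

Lemma itv_chain_bounded (R : realType) (s : seq (R * R)) :
  exists w : R, forall p, p \in s -> p.2 <= w.
Proof.
elim: s => [|p s [w hw]]; first by exists 0.
exists (Num.max p.2 w) => r; rewrite inE le_max => /orP[/eqP ->|/hw ->].
  by rewrite lexx.
by rewrite orbT.
Qed.

Lemma itv_chain_zip (R : realType) (x : R) s :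
  path <%R x s -> itv_chain x (zip (x :: s) s).
Proof. by elim: s x => //= y s IH x /andP[xy /IH h]; rewrite lexx xy. Qed.

Lemma sum_zip_behead (R : realType) (h : R -> R -> R) (s : seq R) :
  \sum_(n < (size s).-1) h s`_n s`_n.+1 = \sum_(p <- zip s (behead s)) h p.1 p.2.
Proof.
elim: s => [|x [|y s] IH]; rewrite /= ?big_nil ?big_ord0//.
by rewrite big_ord_recl big_cons /=; congr (_ + _); exact: IH.
Qed.

Section fmax_riesz.
Variables (R : realType) (beta V : R) (J : R -> R -> R) (T F : R -> R) (q : R).
Hypothesis FD : fmax_data beta V J T F.
Hypothesis qE : q * (1 - beta) = 1.

Lemma fmax_q_ge1 : 1 <= q.
Proof. by case/andP: (fmax_alpha FD); have := qE; nra. Qed.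

(** Decreasing steps contribute at most 4 V^q, increasing ones as much after reflection, and
    constant ones nothing. *)
Lemma fmax_chain_sum z s : itv_chain z s ->
  \sum_(p <- s) riesz_term q F p <= 8 * V `^ q.
Proof.
move=> cs; rewrite (bigID (fun p => F p.2 < F p.1)) /=.
have -> : 8 * V `^ q = 4 * V `^ q + 4 * V `^ q by ring.
apply: lerD.
  rewrite -big_filter; apply: (fmax_dec_sum FD qE (itv_chain_filter _ cs)).
  by move=> p; rewrite mem_filter => /andP[].
rewrite (bigID (fun p => F p.1 < F p.2)) /= [X in _ + X]big1 ?addr0; last first.
  move=> p /andP[]; rewrite -!leNgt => h1 h2.
  rewrite /riesz_term (_ : F p.2 - F p.1 = 0); last by apply/eqP; rewrite subr_eq0 eq_le h1 h2.
  by rewrite normr0 powR0 ?mul0r// gt_eqF//; have := fmax_q_ge1; lra.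
rewrite -big_filter; set s' := [seq _ <- _ | _].
have cs' : itv_chain z s' by exact: itv_chain_filter.
have [w hw] := itv_chain_bounded s'.
have := fmax_dec_sum (fmax_data_opp FD) qE (itv_chain_rev cs' hw).
rewrite big_map big_rev.
have eT p : riesz_term q (fun x => F (- x)) (itv_opp p) = riesz_term q F p.
  rewrite /riesz_term /= !opprK distrC; congr (_ / _ `^ _); ring.
under eq_bigr do rewrite eT.
apply => _ /mapP[p + ->]; rewrite mem_rev mem_filter => /andP[/andP[_ h] _].
by rewrite /= !opprK.
Qed.

Lemma fmax_riesz_variation_le :
  (riesz_variation q F <= (8 `^ (1 / q) * V)%:E)%E.
Proof.
have q1 := fmax_q_ge1; have V0 := fmax_V_ge0 FD.
apply: ub_ereal_sup => _ [s ss <-]; rewrite lee_fin.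
have -> : 8 `^ (1 / q) * V = (8 * V `^ q) `^ q^-1.
  by rewrite powRM ?powR_ge0// -powRrM mulfV ?powRr1 ?div1r//; lra.
apply: ge0_ler_powR; rewrite ?nnegrE.
- by rewrite invr_ge0; lra.
- by apply: sumr_ge0 => i _; rewrite divr_ge0 ?powR_ge0.
- by rewrite mulr_ge0 ?powR_ge0.
rewrite (@sum_zip_behead _ (fun a b => `|F b - F a| `^ q / `|b - a| `^ (q - 1))).
case: s ss => [|x s] /= ss; first by rewrite big_nil mulr_ge0 ?powR_ge0.
have cs := itv_chain_zip ss.
apply: le_trans (fmax_chain_sum cs); rewrite le_eqVlt; apply/orP; left; apply/eqP.
rewrite big_seq [RHS]big_seq; apply: eq_bigr => p ps.
have [_ pp] := itv_chain_mem cs ps.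
by rewrite /riesz_term [X in _ / X `^ _]ger0_norm// subr_ge0 ltW.
Qed.

End fmax_riesz.

(** * Suprema over chains, and absolute continuity for q > 1 *)

Definition chain_sup (R : realType) (phi : R * R -> R) (z : R) : R :=
  sup [set \sum_(p <- s) phi p | s in [set s | itv_chain z s]].

Section chain_sup.
Variables (R : realType) (phi : R * R -> R) (W : R -> R).
Hypothesis phiW : forall z s, itv_chain z s -> \sum_(p <- s) phi p <= W z.

Lemma chain_sup_has_sup z :
  has_sup [set \sum_(p <- s) phi p | s in [set s | itv_chain z s]].
Proof.
split; first by exists (\sum_(p <- [::]) phi p), [::].
by exists (W z) => _ [s cs <-]; exact: phiW.
Qed.

Lemma chain_sup_ub z s : itv_chain z s -> \sum_(p <- s) phi p <= chain_sup phi z.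
Proof.
move=> cs; apply: (ub_le_sup (proj2 (chain_sup_has_sup z))).
by exists s.
Qed.

Lemma chain_sup_ge0 z : 0 <= chain_sup phi z.
Proof. by have := @chain_sup_ub z [::] erefl; rewrite big_nil. Qed.

Lemma chain_sup_le z : chain_sup phi z <= W z.
Proof.
apply: ge_sup; first by have [] := chain_sup_has_sup z.
by move=> _ [s cs <-]; exact: phiW.
Qed.

(** Prepending [x, y] to a chain starting at [y] shows that the drops of [chain_sup phi] dominate
    [phi]; this function plays the part of a variation function. *)
Lemma chain_sup_cons x y : x < y -> phi (x, y) + chain_sup phi y <= chain_sup phi x.
Proof.
move=> xy; rewrite -lerBrDl; apply: ge_sup; first by have [] := chain_sup_has_sup y.
move=> _ [s cs <-]; rewrite lerBrDl.
by have := @chain_sup_ub x ((x, y) :: s); rewrite big_cons; apply; rewrite /= lexx xy.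
Qed.

Lemma chain_sup_nonincreasing x y : x <= y -> chain_sup phi y <= chain_sup phi x.
Proof.
move=> xy; apply: ge_sup; first by have [] := chain_sup_has_sup y.
by move=> _ [s cs <-]; apply: chain_sup_ub; exact: itv_chain_le cs.
Qed.

End chain_sup.

(* A pointwise form of absolute continuity on the line: up to a Lipschitz part,
   increments are dominated by those of a nondecreasing function of small range. *)
Definition ac_dominated (R : realType) (F : R -> R) : Prop :=
  forall e : R, 0 < e -> exists (K : R) (E : R -> R),
    [/\ 0 <= K, {homo E : x y / x <= y}, (forall x, 0 <= E x <= e) &
        forall x y, x <= y -> `|F y - F x| <= E y - E x + K * (y - x)].

(** An increment D > K (y - x) satisfies D <= K^(1 - q) D^q / (y - x)^(q - 1), and the drops of [N]
    control the right-hand side. The range of K^(1 - q) N is at most [e] for large [K]. *)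
Lemma riesz_ac_dominated (R : realType) (q W : R) (F : R -> R) : 1 < q ->
  (forall z s, itv_chain z s -> \sum_(p <- s) riesz_term q F p <= W) ->
  ac_dominated F.
Proof.
move=> q1 FW e e0.
have W0 : 0 <= W by have := FW 0 [::] erefl; rewrite big_nil.
have q10 : 0 < q - 1 by lra.
(* Chosen so that W / K^(q - 1) <= e; the summand 1 keeps [K] positive when [W = 0]. *)
pose K := (W / e) `^ (q - 1)^-1 + 1.
have K0 : 0 < K by rewrite ltr_wpDl ?powR_ge0.
have Kq0 : 0 < K `^ (q - 1) by exact: powR_gt0.
have WK : W / K `^ (q - 1) <= e.
  rewrite ler_pdivrMr// mulrC -ler_pdivrMr//.
  have We0 : 0 <= W / e by rewrite divr_ge0// ltW.
  have -> : W / e = ((W / e) `^ (q - 1)^-1) `^ (q - 1).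
    by rewrite -powRrM mulVf ?powRr1// gt_eqF.
  by apply: ge0_ler_powR; rewrite ?nnegrE ?powR_ge0 ?(ltW K0) ?(ltW q10)// lerDl.
pose N := chain_sup (riesz_term q F).
exists K, (fun z => (W - N z) / K `^ (q - 1)); split.
- exact: ltW.
- move=> x y xy; rewrite ler_pM2r ?invr_gt0//.
  by rewrite lerD2l lerN2 (chain_sup_nonincreasing FW).
- move=> x; have N0 := chain_sup_ge0 FW x; have NW := chain_sup_le FW x.
  rewrite divr_ge0 ?subr_ge0 ?(ltW Kq0)//=; apply: le_trans WK.
  by rewrite ler_pM2r ?invr_gt0// gerBl.
- move=> x y; rewrite le_eqVlt => /orP[/eqP <-|xy]; first by rewrite !subrr normr0 mulr0 addr0.
  have := chain_sup_cons FW xy; rewrite -/N /riesz_term /=.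
  set D := `|_|; move=> hN.
  have h0 : 0 < y - x by rewrite subr_gt0.
  have hq0 : 0 < (y - x) `^ (q - 1) by exact: powR_gt0.
  have E0 : 0 <= N x - N y by rewrite subr_ge0 (chain_sup_nonincreasing FW) ?ltW.
  rewrite -mulrBl (_ : W - N y - (W - N x) = N x - N y); last by ring.
  have [DK|KD] := leP D (K * (y - x)).
    by apply: le_trans DK _; rewrite lerDr divr_ge0// ltW.
  have D0 : 0 < D by apply: le_lt_trans KD; rewrite mulr_ge0// ltW.
  apply: (@le_trans _ _ ((N x - N y) / K `^ (q - 1))); last first.
    by rewrite lerDl mulr_ge0 ?ltW.
  apply: (@le_trans _ _ (D `^ q / (y - x) `^ (q - 1) / K `^ (q - 1))); last first.
    by rewrite ler_pM2r ?invr_gt0//; lra.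
  rewrite -mulrA -invfM -powRM ?(ltW K0) ?(ltW h0)//.
  have P0 : 0 < ((y - x) * K) `^ (q - 1) by rewrite powR_gt0// mulr_gt0.
  rewrite ler_pdivlMr//.
  have -> : D `^ q = D * D `^ (q - 1) by rewrite mulr_powRB1 ?(ltW D0)//; lra.
  apply: ler_wpM2l; first exact: ltW.
  by apply: ge0_ler_powR; rewrite ?nnegrE ?mulr_ge0 ?(ltW D0) ?(ltW h0) ?(ltW K0) ?(ltW q10)// mulrC ltW.
Qed.

(** * Absolute continuity for beta = 0 *)

(* The left-sided maximal function for [beta = 0]. Averages over adjacent intervals
   concatenate, so wherever it stays above a level [t] on [p, z], the level [t] is
   already reached by an average over an interval that starts to the left of [p]. *)
Definition left_maximal (R : realType) (J : R -> R -> R) (x : R) : R :=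
  sup [set J c x / (x - c) | c in [set c | c < x]].

Section fmax_left.
Variables (R : realType) (V : R) (J : R -> R -> R) (T F : R -> R).
Hypothesis FD : fmax_data 0 V J T F.
Local Notation m := (left_maximal J).

Lemma powR_alpha0 (c d : R) : c < d -> (d - c) `^ (1 - 0) = d - c.
Proof. by move=> cd; rewrite subr0 powRr1// subr_ge0 ltW. Qed.

Lemma fmax0_ub x c d : c <= x -> x <= d -> c < d -> J c d / (d - c) <= F x.
Proof. by move=> cx xd cd; have := fmax_ub FD cx xd cd; rewrite powR_alpha0. Qed.

Lemma left_maximal_has_sup x : has_sup [set J c x / (x - c) | c in [set c | c < x]].
Proof.
split; first by exists (J (x - 1) x / (x - (x - 1))), (x - 1) => //=; rewrite gtrBl.
by exists (F x) => _ [c /= cx <-]; apply: fmax0_ub => //; exact: ltW.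
Qed.

Lemma left_maximal_ub x c : c < x -> J c x / (x - c) <= m x.
Proof.
by move=> cx; apply: (ub_le_sup (proj2 (left_maximal_has_sup x))); exists c.
Qed.

Lemma left_maximal_approx x (e : R) : 0 < e -> exists2 c, c < x & m x - e < J c x / (x - c).
Proof.
move=> e0; have [_ [c /= cx <-] h] := sup_adherent e0 (left_maximal_has_sup x).
by exists c.
Qed.

Lemma left_maximal_le x : m x <= F x.
Proof.
apply: ge_sup; first by have [] := left_maximal_has_sup x.
by move=> _ [c /= cx <-]; apply: fmax0_ub => //; exact: ltW.
Qed.

Lemma left_maximal_ge0 x : 0 <= m x.
Proof.
have x1 : x - 1 < x by rewrite gtrBl.
apply: le_trans (left_maximal_ub x1).
by rewrite divr_ge0 ?subr_ge0 ?(fmax_J_ge0 FD) ?(ltW x1).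
Qed.

(** An almost optimal interval for [x] either contains [y], so that [F] hardly drops, or ends at
    some [d < y], where it is a competitor for [m d]. *)
Lemma fmax0_drop x y (e : R) : 0 < e -> x <= y ->
  F x - F y <= e \/ exists d, [/\ x <= d, d < y & F x - F y <= m d - m y + e].
Proof.
move=> e0 xy; have [c [d [cx xd cd]]] := fmax_approx FD x e0.
rewrite powR_alpha0// => h; have [yd|dy] := leP y d.
  by left; have := fmax0_ub (le_trans cx xy) yd cd; lra.
right; exists d; split => //.
by have := left_maximal_ub cd; have := left_maximal_le y; lra.
Qed.

(** An almost optimal interval for [y] that starts before [x] can be cut at [x]: its left part has
    average at most [m x]. What remains is compared with [x - r, x]. *)
Lemma left_maximal_rise x y r : x < y -> 0 < r -> m y - m x <= T y - T (x - r).
Proof.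
move=> xy r0; have [_ _ J0 JD Tnd T0 TV osc _ _] := FD.
apply/ler_addgt0Pl => e e0.
have [c cy h] := left_maximal_approx y e0.
have xr : x - r < x by rewrite gtrBl.
have Tr : T (x - r) <= T y by apply: Tnd; lra.
have [mx|mx] := leP (m y - e) (m x); first by lra.
have [c' [xc' c'y h']] : exists c', [/\ x <= c', c' < y & m y - e < J c' y / (y - c')].
  have [xc|cx] := leP x c; first by exists c.
  exists x; split => //; rewrite ltr_pdivlMr ?subr_gt0//.
  move: h; rewrite ltr_pdivlMr ?subr_gt0// (JD c x y (ltW cx) (ltW xy)).
  have := left_maximal_ub cx; rewrite ler_pdivrMr ?subr_gt0// => h1.
  have : m x * (x - c) < (m y - e) * (x - c) by rewrite ltr_pM2r ?subr_gt0.
  by move: (m x) (m y) h1 => *; lra.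
have := osc _ _ _ _ xr xc' c'y; rewrite distrC => /(le_trans (ler_norm _)).
have := left_maximal_ub xr; lra.
Qed.

(** The drops are the overall decrease of [m] plus its rises in the gaps. With [r] the length of the
    preceding interval, [z - r] is the left end of that interval, so the bounds on the rises
    telescope. *)
Lemma left_maximal_drops r z s : 0 < r -> itv_chain z s ->
  \sum_(p <- s) (m p.1 - m p.2) <= m z + 2 * V - T (z - r) - T z.
Proof.
have [_ _ _ _ Tnd T0 TV _ _ _] := FD.
elim: s z r => [|[x y] s IH] z r r0 /=.
  by move=> _; rewrite big_nil; have := left_maximal_ge0 z; have := TV z; have := TV (z - r); lra.
move=> /and3P[zx xy ch]; rewrite big_cons /=.
have yx0 : 0 < y - x by rewrite subr_gt0.
have := IH y (y - x) yx0 ch; rewrite subKr.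
have : m x - m z <= T x - T (z - r).
  move: zx; rewrite le_eqVlt => /orP[/eqP ->|zx]; last exact: left_maximal_rise.
  by rewrite subrr subr_ge0 Tnd// gerBl ltW.
have : T z <= T y by apply: Tnd; exact: le_trans zx (ltW xy).
by move: (\sum_(_ <- _) _) (m _) (m _) (m _) => *; lra.
Qed.

Lemma left_maximal_drops_le z s : itv_chain z s ->
  \sum_(p <- s) (m p.1 - m p.2) <= 3 * V + J 0 1.
Proof.
(* Moving the start to the left of 0 makes every interval ending there comparable with [0, 1], which
   bounds the remaining value of [m]. *)
move=> ch; have z0 : Num.min z 0 <= 0 by rewrite ge_min lexx orbT.
have {}ch : itv_chain (Num.min z 0) s by apply: itv_chain_le ch; rewrite ge_min lexx.
have [_ _ _ _ _ T0 TV osc _ _] := FD.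
have := left_maximal_drops ltr01 ch.
have : m (Num.min z 0) <= V + J 0 1.
  apply: ge_sup; first by have [] := left_maximal_has_sup (Num.min z 0).
  move=> _ [c /= cz <-].
  have := osc c (Num.min z 0) 0 1 cz z0 ltr01; rewrite subr0 divr1.
  by move=> /(le_trans (ler_norm _)); have := TV 1; have := T0 c; lra.
by have := T0 (Num.min z 0 - 1); have := T0 (Num.min z 0); lra.
Qed.

Lemma left_maximal_extend p z (t : R) : p < z -> (forall v, p <= v -> v <= z -> t < m v) ->
  exists2 c, c <= p & t * (z - c) <= J c z.
Proof.
move=> pz tm; have [_ _ J0 JD _ _ _ _ _ _] := FD.
apply: contrapT => /forall2NP no.
(* If all such starting points lay to the right of [p], their infimum would be attained, and an
   interval of level [t] attached on its left would contradict minimality. *)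
pose S := [set c | c < z /\ t * (z - c) <= J c z].
have Sp c : S c -> p < c.
  by move=> [cz h]; rewrite ltNge; apply/negP => cp; case: (no c).
have start v : p <= v -> v <= z -> exists2 c, c < v & t * (v - c) <= J c v.
  move=> pv vz; have := tm v pv vz; rewrite -subr_gt0 => /(left_maximal_approx v).
  move=> [c cv]; rewrite subKr ltr_pdivlMr ?subr_gt0// => h; exists c => //; exact: ltW.
have [c0 c0z c0S] := start z (ltW pz) (lexx _).
have S0 : S !=set0 by exists c0.
have lbS : has_lbound S by exists p => c /Sp/ltW.
have Si : S (inf S).
  have iz : inf S < z by apply: le_lt_trans (c0z); apply: (ge_inf lbS).
  split => //; apply/ler_addgt0Pl => e e0.
  have [t0|t0] := leP t 0.
    have : 0 <= J (inf S) z by apply: J0; exact: ltW.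
    have : t * (z - inf S) <= 0 by rewrite mulr_le0_ge0// subr_ge0 ltW.
    lra.
  have et0 : 0 < e / t by rewrite divr_gt0.
  have [c [cz hc] ci] := inf_adherent et0 (conj S0 lbS).
  have ic : inf S <= c by apply: (ge_inf lbS).
  rewrite (JD _ _ _ ic (ltW cz)).
  have : 0 <= J (inf S) c by exact: J0.
  have : t * (c - inf S) <= e by rewrite mulrC -ler_pdivlMr//; lra.
  by lra.
have [iz hi] := Si; have pi := Sp _ Si.
have [c ci hc] := start _ (ltW pi) (ltW iz).
have /(ge_inf lbS) : S c.
  split; first exact: lt_trans ci iz.
  by rewrite (JD _ _ _ (ltW ci) (ltW iz)); lra.
by rewrite leNgt ci.
Qed.

(** A level just below [t] is reached at [z] by an interval of length at least [z - p]; translating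
    it until it ends at [y] loses at most (y - z) V / (z - p). *)
Lemma left_maximal_lip p z y (t : R) : p < z -> z <= y ->
  (forall v, p <= v -> v <= z -> t <= m v) -> t - m y <= V / (z - p) * (y - z).
Proof.
move=> pz; rewrite le_eqVlt => /orP[/eqP <-|zy] tm.
  by rewrite subrr mulr0 subr_le0; apply: tm => //; exact: ltW.
apply/ler_addgt0Pl => e e0.
have V0 := fmax_V_ge0 FD.
have zp0 : 0 < z - p by rewrite subr_gt0.
have [|c cp hc] := @left_maximal_extend p z (t - e) pz.
  by move=> v pv vz; have := tm v pv vz; lra.
have cz : c < z by exact: le_lt_trans pz.
have zc0 : 0 < z - c by rewrite subr_gt0.
have := fmax_J_shift FD cz zy.
have cy : c + (y - z) < y by lra.
have := left_maximal_ub cy; rewrite (_ : y - (c + (y - z)) = z - c); last by ring.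
rewrite ler_pdivrMr// => h1 h2.
have h3 : (t - e - m y) * (z - c) <= (y - z) * V by lra.
have h4 : t - e - m y <= (y - z) * V / (z - c) by rewrite ler_pdivlMr.
have : (y - z) * V / (z - c) <= V / (z - p) * (y - z).
  rewrite [leRHS]mulrAC [V * _]mulrC; apply: ler_wpM2l.
    by rewrite mulr_ge0// subr_ge0 ltW.
  by rewrite lef_pV2 ?posrE// lerD2l lerN2.
lra.
Qed.

Lemma left_maximal_lsc p (h : R) : 0 < h ->
  exists2 d : R, 0 < d & forall z, p <= z -> z <= p + d -> m p - h <= m z.
Proof.
move=> h0; have [_ _ J0 JD _ _ _ _ _ _] := FD.
have h20 : 0 < h / 2 by rewrite divr_gt0.
have [c cp] := left_maximal_approx p h20.
have pc0 : 0 < p - c by rewrite subr_gt0.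
rewrite ltr_pdivlMr// => hc.
have m1 : 0 < m p + 1 by have := left_maximal_ge0 p; lra.
(* Extending [c, p] up to [z] dilutes its average by at most [h / 2] at this distance; the summand 1
   keeps the denominator positive. *)
exists (h / 2 * (p - c) / (m p + 1)); first by rewrite divr_gt0// mulr_gt0.
move=> z pz zd.
have cz : c < z by exact: lt_le_trans pz.
apply: le_trans (left_maximal_ub cz); rewrite ler_pdivlMr ?subr_gt0//.
rewrite (JD c p z (ltW cp) pz); have := J0 p z pz.
have : (m p + 1) * (z - p) <= h / 2 * (p - c).
  by rewrite mulrC -ler_pdivlMr//; lra.
have zp0 : 0 <= z - p by rewrite subr_ge0.
move: (m p) (J c p) (J p z) hc m1 {zd} => mp J1 J2 hc m1 h1 h2.
nra.
Qed.

End fmax_left.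

(** * Drops split into a small monotone part and a Lipschitz part *)

Section drop_domination.
Variables (R : realType) (V W : R) (m : R -> R).
Hypothesis V0 : 0 <= V.
Hypothesis m0 : forall x, 0 <= m x.
Hypothesis m_drops : forall z s, itv_chain z s -> \sum_(p <- s) (m p.1 - m p.2) <= W.
Hypothesis m_lip : forall (p z y t : R), p < z -> z <= y ->
  (forall v, p <= v -> v <= z -> t <= m v) -> t - m y <= V / (z - p) * (y - z).
Hypothesis m_lsc : forall (p h : R), 0 < h ->
  exists2 d : R, 0 < d & forall z, p <= z -> z <= p + d -> m p - h <= m z.

Local Notation N := (chain_sup (fun p : R * R => m p.1 - m p.2)).
Local Notation mu p z := (inf [set m v | v in [set v | p <= v <= z]]).

Let N_cons x y : x < y -> m x - m y + N y <= N x.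
Proof. exact: (chain_sup_cons m_drops). Qed.

Let N_le x y : x <= y -> N y <= N x.
Proof. exact: (chain_sup_nonincreasing m_drops). Qed.

(** The running infimum [mu] loses at most [h] before [q = p + d] and is Lipschitz with constant
    [V / d] beyond. Removing from [- N] the part due to the fall of [mu] beyond [q] leaves [E],
    whose growth is the excess of [N] over the single drop [m p - m p'], up to [h]. *)
Lemma drop_dominated_itv p p' (h : R) : 0 < h -> p < p' ->
  exists (K : R) (E : R -> R), [/\ 0 <= K,
    forall x y, p <= x -> x <= y -> y <= p' ->
      E x <= E y /\ N x - N y <= E y - E x + K * (y - x) &
    E p' - E p <= N p - N p' - (m p - m p') + h].
Proof.
move=> h0 pp'.
have has_mu z : p <= z -> has_inf [set m v | v in [set v | p <= v <= z]].
  move=> pz; split; first by exists (m p), p; rewrite //= lexx.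
  by exists 0 => _ [v _ <-].
have mu_lb z v : p <= v -> v <= z -> mu p z <= m v.
  move=> pv vz; apply: (ge_inf (proj2 (has_mu _ (le_trans pv vz)))).
  by exists v => //=; rewrite pv.
have mu_glb z (t : R) : p <= z -> (forall v, p <= v -> v <= z -> t <= m v) -> t <= mu p z.
  move=> pz tm; apply: lb_le_inf; first by case: (has_mu z pz).
  by move=> _ [v /= /andP[pv vz] <-]; exact: tm.
have mu_le x y : p <= x -> x <= y -> mu p y <= mu p x.
  move=> px xy; apply: mu_glb => // v pv vx; apply: mu_lb => //; exact: le_trans xy.
(* A fall of [mu] comes from a drop of [m], which [N] accounts for; this makes [E] monotone. *)
have kappa x y : p <= x -> x <= y -> mu p x - N x <= mu p y - N y.
  move=> px xy; have key : mu p x - (N x - N y) <= mu p y.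
    apply: mu_glb => [|v pv vy]; first exact: le_trans xy.
    have [vx|xv] := leP v x; first by have := mu_lb _ _ pv vx; have := N_le xy; lra.
    by have := mu_lb _ _ px (lexx _); have := N_cons xv; have := N_le vy; lra.
  by lra.
have [d d0 md] := m_lsc p h0.
pose q := p + d.
have pq : p < q by rewrite ltrDl.
have mupp : mu p p = m p.
  apply/eqP; rewrite eq_le mu_lb//= mu_glb// => v pv vp.
  by have -> : v = p by apply/eqP; rewrite eq_le vp.
have muq : m p - h <= mu p q by apply: mu_glb => //; exact: ltW.
(* As mu (min z q) + mu (max z q) = mu z + mu q, this is [- N z] plus the running infimum at max z
   q, up to a constant. *)
pose E z := mu p z - N z - mu p (Num.min z q).
have Emin z : p <= z -> p <= Num.min z q by move=> pz; rewrite le_min pz ltW.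
exists (V / d), E; split; first by rewrite divr_ge0// ltW.
- move=> x y px xy yp'; have py : p <= y := le_trans px xy.
  have minxy : Num.min x q <= Num.min y q by rewrite le_min !ge_min xy lexx orbT.
  have k1 := kappa _ _ px xy; have k2 := mu_le _ _ (Emin _ px) minxy.
  split; first by rewrite /E; lra.
  have k3 : mu p (Num.max x q) - mu p (Num.max y q) <= V / d * (y - x).
    have qx : q <= Num.max x q by rewrite le_max lexx orbT.
    have maxxy : Num.max x q <= Num.max y q by rewrite ge_max !le_max xy lexx orbT.
    have maxd : Num.max y q - Num.max x q <= y - x.
      by rewrite !maxEle; case: ifP; case: ifP => /idP + /idP; rewrite ?(negPf, negP); lra.
    have Vd0 : 0 <= V / d by rewrite divr_ge0// ltW.
    have pM : p < Num.max x q by exact: lt_le_trans qx.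
    suff : mu p (Num.max x q) - V / d * (Num.max y q - Num.max x q) <= mu p (Num.max y q).
      by have : V / d * (Num.max y q - Num.max x q) <= V / d * (y - x) by [exact: ler_wpM2l]; lra.
    apply: mu_glb; first by apply: le_trans maxxy; exact: ltW.
    move=> v pv vM; have [vx|xv] := leP v (Num.max x q).
      have := mu_lb _ _ pv vx.
      have : 0 <= V / d * (Num.max y q - Num.max x q) by rewrite mulr_ge0// subr_ge0.
      by lra.
    have := m_lip pM (ltW xv) (fun w pw wx => mu_lb _ w pw wx).
    have : V / (Num.max x q - p) * (v - Num.max x q) <= V / d * (Num.max y q - Num.max x q).
      apply: ler_pM; rewrite ?divr_ge0 ?subr_ge0 ?(ltW pM) ?(ltW xv) ?lerD2r//.
      rewrite ler_wpM2l// lef_pV2 ?posrE ?subr_gt0//.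
      by move: qx; rewrite /q; lra.
    by lra.
  have ex z : p <= z -> mu p (Num.min z q) + mu p (Num.max z q) = mu p z + mu p q.
    by move=> pz; case: (leP z q) => zq //; rewrite addrC.
  by have := ex _ px; have := ex _ py; rewrite /E; lra.
- have mupq : mu p p - mu p (Num.min p' q) <= h.
    have : mu p q <= mu p (Num.min p' q).
      by apply: mu_le; [exact/Emin/ltW|rewrite ge_min lexx orbT].
    by rewrite mupp; lra.
  have minpq : Num.min p q = p by rewrite min_l// ltW.
  have : mu p p' <= m p' by apply: mu_lb => //; exact: ltW.
  by move: mupq; rewrite /E minpq mupp; lra.
Qed.

(** [E] is glued from [- N] before the first interval, the previous construction on it, and the
    induction hypothesis after it. Its growth is small when the chain almost attains [N a]. *)
Lemma drop_dominated_chain s a (h : R) : 0 < h -> itv_chain a s ->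
  exists (K : R) (E : R -> R), [/\ 0 <= K,
    forall x y, a <= x -> x <= y -> E x <= E y /\ N x - N y <= E y - E x + K * (y - x) &
    forall y, a <= y -> E y - E a <= N a - \sum_(p <- s) (m p.1 - m p.2) + h].
Proof.
elim: s a h => [|[p p'] s IH] a h h0 /=.
  move=> _; exists 0, (fun z => - N z); split => //.
    by move=> x y ax xy; have := N_le xy; rewrite mul0r; lra.
  by move=> y ay; rewrite big_nil; have := chain_sup_ge0 m_drops y; lra.
move=> /and3P[ap pp' ch]; rewrite big_cons /=.
have h2 : 0 < h / 2 by rewrite divr_gt0.
have [K1 [E1 [K10 hE1 tE1]]] := drop_dominated_itv h2 pp'.
have [K2 [E2 [K20 hE2 tE2]]] := IH p' _ h2 ch.
(* Clamping to [p, p'] is monotone and 1-Lipschitz, and splits [N] into its parts before, on and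
   after the interval. *)
pose c z := Num.max p (Num.min z p').
have pc z : p <= c z by rewrite le_max lexx.
have cp z : c z <= p' by rewrite ge_max (ltW pp') ge_min lexx orbT.
have c_le x y : x <= y -> c x <= c y.
  move=> xy; have mn : Num.min x p' <= Num.min y p' by rewrite le_min !ge_min xy lexx orbT.
  by rewrite ge_max !le_max lexx mn orbT.
have c_lip x y : x <= y -> c y - c x <= y - x.
  move=> xy; rewrite /c !maxEle !minEle.
  by do !case: ifPn; rewrite -?ltNge; lra.
have min_le x y : x <= y -> Num.min x p <= Num.min y p.
  by move=> xy; rewrite le_min !ge_min xy lexx orbT.
have max_le x y : x <= y -> Num.max x p' <= Num.max y p'.
  by move=> xy; rewrite ge_max !le_max xy lexx orbT.
have max_lip x y : x <= y -> Num.max y p' - Num.max x p' <= y - x.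
  by move=> xy; rewrite !maxEle; do !case: ifPn; rewrite -?ltNge; lra.
have NE z : N z = N (Num.min z p) + N (c z) + N (Num.max z p') - N p - N p'.
  rewrite /c; have [zp|pz] := leP z p.
    rewrite (min_l (le_trans zp (ltW pp'))) (max_l zp) max_r; last exact: le_trans (ltW pp').
    by ring.
  have [zp'|pz'] := leP z p'; first by rewrite (max_r (ltW pz)); ring.
  by rewrite (max_r (ltW pp')); ring.
pose E z := - N (Num.min z p) + E1 (c z) + E2 (Num.max z p').
exists (K1 + K2), E; split; first exact: addr_ge0.
- move=> x y ax xy.
  have [i1 d1] := hE1 _ _ (pc x) (c_le _ _ xy) (cp y).
  have p'x : p' <= Num.max x p' by rewrite le_max lexx orbT.
  have [i2 d2] := hE2 _ _ p'x (max_le _ _ xy).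
  have i3 := N_le (min_le _ _ xy).
  split; first by rewrite /E; lra.
  have k1 := ler_wpM2l K10 (c_lip _ _ xy); have k2 := ler_wpM2l K20 (max_lip _ _ xy).
  rewrite /E (NE x) (NE y).
  move: (N _) (N _) (N _) (N _) (N _) (N _) (N _) (N _) (E1 _) (E1 _) (E2 _) (E2 _) i1 d1 i2 d2 i3 k1 k2.
  by clear; move=> *; lra.
- move=> y ay.
  have ca : c a = p by rewrite /c min_l ?max_l//; exact: le_trans (ltW pp').
  have i1 := N_le (min_le _ _ ay); rewrite (min_l ap) in i1.
  have [i2 _] := hE1 _ _ (pc y) (cp y) (lexx _).
  have p'y : p' <= Num.max y p' by rewrite le_max lexx orbT.
  have i3 := tE2 _ p'y.
  have i4 : N p <= N (Num.min y p) by apply: N_le; rewrite ge_min lexx orbT.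
  rewrite /E ca (min_l ap) (max_r (le_trans ap (ltW pp'))).
  by move: i2 i3 i4 tE1; move: (\sum_(_ <- _) _) => *; lra.
Qed.

(** To the left of a suitable [a], [N] varies by at most [e / 4]; to its right one finite chain
    attains [N a] up to [e / 4], and the error of the gluing is [e / 2]. *)
Lemma drop_dominated (e : R) : 0 < e -> exists (K : R) (E : R -> R),
  [/\ 0 <= K, {homo E : x y / x <= y}, (forall x, 0 <= E x <= e) &
      forall x y, x <= y -> N x - N y <= E y - E x + K * (y - x)].
Proof.
move=> e0; have e20 : 0 < e / 2 by rewrite divr_gt0.
pose X := [set N z | z in [set: R]].
have supX : has_sup X.
  split; first by exists (N 0), 0.
  by exists W => _ [z _ <-]; exact: (chain_sup_le m_drops).
have NX z : N z <= sup X by apply: (ub_le_sup (proj2 supX)); exists z.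
have e40 : 0 < e / 4 by rewrite divr_gt0.
have [_ [a _ <-] ha] := sup_adherent e40 supX.
have [_ [s ch <-] hs] := sup_adherent e40 (chain_sup_has_sup m_drops a).
rewrite -/(chain_sup _ a) in hs.
have [K [E [K0 hE tE]]] := drop_dominated_chain e20 ch.
pose E' z := (sup X - N (Num.min z a)) + (E (Num.max z a) - E a).
have am z : a <= Num.max z a by rewrite le_max lexx orbT.
have mono x y : x <= y -> [/\ Num.min x a <= Num.min y a, Num.max x a <= Num.max y a &
    Num.max y a - Num.max x a <= y - x].
  move=> xy; split; first by rewrite le_min !ge_min xy lexx orbT.
    by rewrite ge_max !le_max xy lexx orbT.
  by rewrite !maxEle; do !case: ifPn; rewrite -?ltNge; lra.
exists K, E'; split => //.
- move=> x y /mono[/N_le k1 k2 _]; have [k3 _] := hE _ _ (am x) k2.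
  by rewrite /E'; lra.
- move=> x; have [k1 _] := hE _ _ (lexx _) (am x); have k2 := tE _ (am x).
  have k3 : N a <= N (Num.min x a) by apply: N_le; rewrite ge_min lexx orbT.
  have := NX (Num.min x a); rewrite /E' => k4; apply/andP; split; first by lra.
  by move: k2 hs; move: (\sum_(_ <- _) _) => *; lra.
- move=> x y /mono[/N_le k1 k2 k3]; have [_ k4] := hE _ _ (am x) k2.
  have k5 := ler_wpM2l K0 k3.
  have NE z : N z = N (Num.min z a) + N (Num.max z a) - N a.
    by case: (leP z a) => za; ring.
  rewrite /E' (NE x) (NE y); lra.
Qed.

End drop_domination.

Section fmax0_ac.
Variables (R : realType) (V : R) (J : R -> R -> R) (T F : R -> R).

Lemma fmax0_drop_dominated : fmax_data 0 V J T F ->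
  forall e : R, 0 < e -> exists (K : R) (E : R -> R),
  [/\ 0 <= K, {homo E : x y / x <= y}, (forall x, 0 <= E x <= e) &
      forall x y, x <= y -> F x - F y <= E y - E x + K * (y - x)].
Proof.
move=> FD e e0.
have dr := left_maximal_drops_le FD.
have [K [E [K0 Eh Ee NE]]] := drop_dominated (fmax_V_ge0 FD) (left_maximal_ge0 FD) dr
  (left_maximal_lip FD) (left_maximal_lsc FD) e0.
exists K, E; split => // x y xy; apply: le_trans (NE _ _ xy).
apply/ler_addgt0Pl => h h0.
have N0 := chain_sup_nonincreasing dr xy.
have [|[d [xd dy Fd]]] := fmax0_drop FD h0 xy; first by lra.
have := chain_sup_cons dr dy; have := chain_sup_nonincreasing dr xd.
by rewrite /=; lra.
Qed.

End fmax0_ac.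

Lemma fmax0_ac_dominated (R : realType) (V : R) (J : R -> R -> R) (T F : R -> R) :
  fmax_data 0 V J T F -> ac_dominated F.
Proof.
move=> FD e e0; have e20 : 0 < e / 2 by rewrite divr_gt0.
have [K1 [E1 [K10 E1h E1e FE1]]] := fmax0_drop_dominated FD e20.
have [K2 [E2 [K20 E2h E2e FE2]]] := fmax0_drop_dominated (fmax_data_opp FD) e20.
(* [E1] controls the drops of [F] and the reflected [E2] its rises; the form [e / 2 - E2 (- z)]
   restores monotonicity and positivity. *)
exists (K1 + K2), (fun z => E1 z + (e / 2 - E2 (- z))); split.
- exact: addr_ge0.
- move=> x y xy; have := E1h _ _ xy; have := E2h (- y) (- x); rewrite lerN2 => /(_ xy).
  by lra.
- by move=> x; have /andP[] := E1e x; have /andP[] := E2e (- x); lra.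
- move=> x y xy; have := FE1 _ _ xy; have := FE2 (- y) (- x); rewrite lerN2 => /(_ xy).
  have := E1h _ _ xy; have := E2h (- y) (- x); rewrite lerN2 => /(_ xy).
  have : 0 <= K1 * (y - x) by rewrite mulr_ge0// subr_ge0.
  have : 0 <= K2 * (y - x) by rewrite mulr_ge0// subr_ge0.
  rewrite !opprK ler_norml; lra.
Qed.

(** * The density of an absolutely continuous function *)

Lemma disjoint_itv_le (R : realType) (a b a' b' : R) : a < b -> a' < b' -> a <= a' ->
  [set` `]a, b[] `&` [set` `]a', b'[] = set0 -> b <= a'.
Proof.
move=> ab ab' aa' I0; rewrite leNgt; apply/negP => a'b.
have h : a' < Num.min b b' by rewrite lt_min a'b.
suff : ([set` `]a, b[] `&` [set` `]a', b'[]) ((a' + Num.min b b') / 2) by rewrite I0.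
have [h1 h2] : Num.min b b' <= b /\ Num.min b b' <= b' by rewrite !ge_min !lexx orbT.
by split; rewrite /= in_itv /=; apply/andP; split; lra.
Qed.

Lemma ac_dominated_abs_continuous (R : realType) (F : R -> R) :
  ac_dominated F -> abs_continuous F.
Proof.
move=> acF e e0; have e20 : 0 < e / 2 by rewrite divr_gt0.
have [K [E [K0 Eh Ee FE]]] := acF _ e20.
have K10 : 0 < K + 1 by rewrite ltr_wpDl.
exists (e / 2 / (K + 1)); first by rewrite divr_gt0.
move=> n a b ab /trivIsetP tab len.
(* Sorted by left ends, the disjoint intervals form a chain, along which the increments of [E] add
   up to at most its range [e / 2]. *)
pose l := sort (fun i j => a i <= a j) (enum 'I_n).
have pl : perm_eq (enum 'I_n) l by rewrite perm_sym perm_sort.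
have sl : sorted (fun i j => a i <= a j) l.
  by apply: sort_sorted => i j; exact: le_total.
have ul : uniq l by rewrite -(perm_uniq pl) enum_uniq.
have chE (i : 'I_n) s : path (fun i j => a i <= a j) i s -> uniq (i :: s) ->
    itv_chain (b i) [seq (a j, b j) | j <- s].
  elim: s i => //= j s IH i /andP[aij ps] /andP[]; rewrite inE negb_or => /andP[ij _] us.
  rewrite ab IH// andbT andbT.
  by apply: (disjoint_itv_le (ab i) (ab j) aij); apply: tab.
have EK z s : itv_chain z s -> \sum_(p <- s) (E p.2 - E p.1) <= e / 2 - E z.
  elim: s z => /= [z _|p s IH z /and3P[zp pp /IH]].
    by rewrite big_nil; have /andP[] := Ee z; lra.
  by rewrite big_cons; have := Eh _ _ zp; lra.
have Esum : \sum_(i < n) (E (b i) - E (a i)) <= e / 2.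
  rewrite -big_enum /= (perm_big _ pl) /=.
  case: l sl ul chE {pl} => [|i l] /= sl ul chE; first by rewrite big_nil ltW.
  rewrite -(big_map (fun j => (a j, b j)) xpredT (fun p => E p.2 - E p.1)).
  have := EK (a i) [seq (a j, b j) | j <- i :: l].
  rewrite /= lexx ab chE//= => /(_ erefl).
  by have /andP[] := Ee (a i); lra.
apply: (@le_lt_trans _ _ (\sum_(i < n) ((E (b i) - E (a i)) + K * (b i - a i)))).
  by apply: ler_sum => i _; apply: FE; exact: ltW.
rewrite big_split /= -mulr_sumr.
have : K * \sum_(i < n) (b i - a i) < e / 2.
  have s0 : 0 <= \sum_(i < n) (b i - a i) by apply: sumr_ge0 => i _; rewrite subr_ge0 ltW.
  move: len; rewrite ltr_pdivlMr// mulrC mulrDl mul1r; lra.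
lra.
Qed.

Lemma abs_continuous_continuous (R : realType) (F : R -> R) :
  abs_continuous F -> continuous F.
Proof.
move=> acF x; apply/cvgrPdist_lt => e e0; have [d d0 h] := acF e e0.
have key (a b : R) : a < b -> b - a < d -> `|F b - F a| < e.
  move=> ab abd; have := h 1%N (fun=> a) (fun=> b) (fun=> ab).
  rewrite !big_ord1; apply => //.
  by apply/trivIsetP => i j _ _; rewrite !ord1 eqxx.
near=> y.
have xy : `|x - y| < d by near: y; exact: (@cvgr_dist_lt _ R^o).
have [yx|xy'|->] := ltgtP y x; last by rewrite subrr normr0.
  by apply: key => //; rewrite -(ger0_norm (_ : 0 <= x - y))// subr_ge0 ltW.
by rewrite distrC; apply: key => //; rewrite -(ger0_norm (_ : 0 <= y - x)) ?subr_ge0 1?distrC ?ltW.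
Unshelve. all: by end_near. Qed.

(** * Right-continuous dominating functions *)

Section right_regularization.
Variables (R : realType) (E : R -> R) (e : R).
Hypothesis E_nd : {homo E : x y / x <= y}.
Hypothesis E_bnd : forall x, 0 <= E x <= e.

(** The right limit of the nondecreasing [E]: Stieltjes measures need right-continuous distribution
    functions. *)
Definition right_inf (x : R) : R := inf [set E w | w in [set w | x < w]].

Let has_inf_right x : has_inf [set E w | w in [set w | x < w]].
Proof.
split; first by exists (E (x + 1)), (x + 1) => //=; rewrite ltrDl.
by exists 0 => _ [w _ <-]; have /andP[] := E_bnd w.
Qed.

Lemma right_inf_le x w : x < w -> right_inf x <= E w.
Proof. by move=> xw; apply: (ge_inf (proj2 (has_inf_right x))); exists w. Qed.

Lemma right_inf_ge x : E x <= right_inf x.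
Proof.
apply: lb_le_inf; first by case: (has_inf_right x).
by move=> _ [w /= xw <-]; apply: E_nd; exact: ltW.
Qed.

Lemma right_inf_nd : {homo right_inf : x y / x <= y}.
Proof.
move=> x y; rewrite le_eqVlt => /orP[/eqP ->//|xy].
exact: le_trans (right_inf_le xy) (right_inf_ge y).
Qed.

Lemma right_inf_bnd x : 0 <= right_inf x <= e.
Proof.
have /andP[E0 _] := E_bnd x; have /andP[_ Ee] := E_bnd (x + 1).
rewrite (le_trans E0 (right_inf_ge x)) (le_trans _ Ee)//.
by apply: right_inf_le; rewrite ltrDl.
Qed.

Lemma right_inf_approx x h : 0 < h -> exists2 w, x < w & E w < right_inf x + h.
Proof.
by move=> h0; have [_ [w /= xw <-]] := inf_adherent h0 (has_inf_right x); exists w.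
Qed.

Lemma right_inf_rc : right_continuous right_inf.
Proof.
move=> x; apply/cvgrPdist_le => h h0; have [w xw hw] := right_inf_approx x h0.
near=> y.
have xy : x < y by near: y; exact: nbhs_right_gt.
have yw : y < w by near: y; exact: nbhs_right_lt.
rewrite distrC ger0_norm ?subr_ge0 ?right_inf_nd ?ltW//.
by have := right_inf_le yw; lra.
Unshelve. all: by end_near. Qed.

(** The given bound is applied at points slightly to the right of [x] and [y], and continuity of [F]
    brings it back. *)
Lemma right_inf_dominates (F : R -> R) (K : R) : continuous F -> 0 <= K ->
  (forall x y, x <= y -> `|F y - F x| <= E y - E x + K * (y - x)) ->
  forall x y, x <= y -> `|F y - F x| <= right_inf y - right_inf x + K * (y - x).
Proof.
move=> cF K0 FE x y; rewrite le_eqVlt => /orP[/eqP ->|xy].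
  by rewrite !subrr normr0 mulr0 addr0.
apply/ler_addgt0Pl => h h0.
have h40 : 0 < h / 4 by rewrite divr_gt0.
have [w yw hw] := right_inf_approx y h40.
have K10 : 0 < K + 1 by rewrite ltr_wpDl.
have near_r (z u : R) : z < u -> exists z', [/\ z < z', z' < u, `|F z' - F z| <= h / 4 &
    K * (z' - z) <= h / 4].
  move=> zu.
  have : \forall z' \near z^'+, `|F z' - F z| <= h / 4.
    have /cvgrPdist_le/(_ _ h40) : F t @[t --> z^'+] --> F z.
      by apply: cvg_at_right_filter; exact: cF.
    by apply: filterS => t; rewrite distrC.
  move=> Fz; near z^'+ => z'; exists z'; split.
  - by near: z'; exact: nbhs_right_gt.
  - by near: z'; exact: nbhs_right_lt.
  - by near: z'.
  - have : z' < z + h / 4 / (K + 1).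
      by near: z'; apply: nbhs_right_lt; rewrite ltrDl divr_gt0.
    have zz' : z < z' by near: z'; exact: nbhs_right_gt.
    by rewrite -ltrBlDl ltr_pdivlMr// mulrC mulrDl mul1r; lra.
have [x' [xx' x'y Fx' Kx']] := near_r x y xy.
have [y' [yy' y'w Fy' Ky']] := near_r y w yw.
have := FE x' y' (ltW (lt_trans x'y yy')).
have := right_inf_le xx'; have := E_nd (ltW y'w).
have : `|F y - F x| <= `|F y' - F x'| + `|F y' - F y| + `|F x' - F x|.
  have -> : F y - F x = (F y' - F x') - (F y' - F y) + (F x' - F x) by ring.
  by apply: le_trans (ler_normD _ _) _; rewrite lerD2r ler_normB.
have : K * (y' - x') <= K * (y - x) + K * (y' - y).
  by rewrite -mulrDr ler_wpM2l//; lra.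
move: (right_inf _) (right_inf _) (E _) (E _) (E _) hw (`|_|) Fx' (`|_|) Fy' (`|_|) (`|_|) => *; lra.
Unshelve. all: by end_near. Qed.

End right_regularization.

Definition cumulative_of (R : realType) (f : R -> R) (nd : {homo f : x y / x <= y})
    (rc : right_continuous f) : cumulative R R :=
  HB.pack_for (cumulative R R) f (isCumulative.Build R _ R f nd rc).

(** * Lebesgue-Stieltjes measures *)

Section stieltjes.
Variable R : realType.
Local Notation LS := (@lebesgue_stieltjes_measure R).
Local Notation lebR := (@lebesgue_measure R).

Lemma stieltjes_itv (f : cumulative R R) (a b : R) : a <= b ->
  LS f `]a, b]%classic = (f b - f a)%:E.
Proof.
move=> ab; rewrite /lebesgue_stieltjes_measure /measure_extension.
by rewrite measurable_mu_extE/= ?wlength_itv_bnd//; exact: is_ocitv.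
Qed.

(** Both sides agree on half-open intervals, which determine a Stieltjes measure. *)
Lemma stieltjesD (f g h : cumulative R R) (A : set (measurableTypeR R)) :
  (forall x, h x = f x + g x) -> measurable A -> LS h A = (LS f A + LS g A)%E.
Proof.
move=> hE mA; rewrite -(measure_addE (LS f) (LS g)).
apply: lebesgue_stieltjes_measure_unique => // _ [[a b] _ <-] /=.
rewrite [RHS](_ : _ = LS f `]a, b]%classic + LS g `]a, b]%classic)%E; last exact: measure_addE.
have [ab|ba] := leP a b; last first.
  by rewrite set_itv_ge ?bnd_simp -?leNgt ?(ltW ba)// !measure0 adde0.
by rewrite !stieltjes_itv// -EFinD !hE; congr _%:E; ring.
Qed.

Lemma stieltjes_linear_null (K : R) (f : cumulative R R) (A : set (measurableTypeR R)) :
  0 <= K -> (forall x, f x = K * x) -> measurable A -> lebR A = 0%E -> LS f A = 0%E.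
Proof.
move=> K0 fE mA A0; have -> : LS f A = mscale (NngNum K0) lebR A.
  apply: lebesgue_stieltjes_measure_unique => // _ [[a b] _ <-] /=.
  rewrite /mscale /=; have [ab|ba] := leP a b; last first.
    by rewrite set_itv_ge ?bnd_simp -?leNgt ?(ltW ba)// !measure0 mule0.
  by rewrite stieltjes_itv// [lebesgue_measure _]stieltjes_itv//= -EFinM !fE -mulrBr.
by rewrite /mscale /= [lebesgue_measure _]A0 mule0.
Qed.

End stieltjes.

Section ac_density.
Variables (R : realType) (F : R -> R).
Hypothesis acF : ac_dominated F.
Local Notation LS := (@lebesgue_stieltjes_measure R).
Local Notation lebR := (@lebesgue_measure R).

Let F_cont : continuous F.
Proof. exact/abs_continuous_continuous/ac_dominated_abs_continuous. Qed.

Lemma ac_dominated_rc (e : R) : 0 < e -> exists (K : R) (E : R -> R),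
  [/\ 0 <= K, {homo E : x y / x <= y}, right_continuous E, (forall x, 0 <= E x <= e) &
      forall x y, x <= y -> `|F y - F x| <= E y - E x + K * (y - x)].
Proof.
move=> e0; have [K [E [K0 Eh Ee FE]]] := acF e0.
exists K, (right_inf E); split => //.
- exact: (right_inf_nd Eh Ee).
- exact: (right_inf_rc Eh Ee).
- exact: (right_inf_bnd Eh Ee).
- exact: (right_inf_dominates Eh Ee F_cont K0 FE).
Qed.

Let add_rc (f g : R -> R) : right_continuous f -> right_continuous g ->
  right_continuous (f \+ g).
Proof. by move=> cf cg x; exact: cvgD. Qed.

Let lin_rc (K : R) : right_continuous (fun x : R => K * x).
Proof. by apply: right_continuousW => x; apply: cvgMr; exact: cvg_id. Qed.

Let F_rc : right_continuous F.
Proof. exact: right_continuousW. Qed.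

Let NF_rc : right_continuous (\- F).
Proof. by move=> x; apply: cvgN; exact: F_rc. Qed.

(** With B = K x + E, both [B] and H = F + B are nondecreasing, so [F] is the distribution function
    of the difference of their Stieltjes measures on ]c, d]. This charge vanishes on null sets and
    has a Radon-Nikodym density. The integral from -oo is the form used for differentiation. *)
Lemma ac_density (c d : R) : c < d -> exists psi : R -> R,
  lebR.-integrable setT (EFin \o psi) /\
  forall x y, c <= x -> x <= y -> y <= d ->
    (\int[lebR]_(t in [set` `]x, y]]) (psi t)%:E = (F y - F x)%:E)%E /\
    (\int[lebR]_(t in [set` `]-oo, y]]) (psi t)%:E = (F y - F c)%:E)%E.
Proof.
move=> cd.
have [K [E [K0 Eh Erc _ FE]]] := ac_dominated_rc ltr01.
pose lin (L : R) (L0 : 0 <= L) := cumulative_of (fun x y (xy : x <= y) => ler_wpM2l L0 xy) (@lin_rc L).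
have dom_nd (f g : R -> R) : (forall x y, x <= y -> f x - f y <= g y - g x) ->
    {homo (f \+ g) : x y / x <= y}.
  by move=> h x y /h /=; lra.
have B_nd : {homo (fun x : R => K * x) \+ E : x y / x <= y}.
  by move=> x y xy; apply: lerD; [exact: ler_wpM2l|exact: (Eh)].
pose cB := cumulative_of B_nd (add_rc (@lin_rc K) Erc).
have H_nd : {homo F \+ ((fun x : R => K * x) \+ E) : x y / x <= y}.
  apply: dom_nd => x y xy /=; have := FE x y xy.
  by rewrite ler_norml => /andP[h _]; lra.
pose cH := cumulative_of H_nd (add_rc F_rc (add_rc (@lin_rc K) Erc)).
pose D : set (measurableTypeR R) := [set` `]c, d]].
have mD : measurable D by exact: measurable_itv.
have fin (f : cumulative R R) : (LS f D < +oo)%E by rewrite stieltjes_itv ?ltry// ltW.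
have null (A : set (measurableTypeR R)) : measurable A -> A `<=` D -> lebR A = 0%E ->
    LS cH A = LS cB A.
  move=> mA AD A0.
  have finA (f : cumulative R R) : LS f A \is a fin_num.
    rewrite ge0_fin_numE//; apply: le_lt_trans (fin f).
    by apply: le_measure => //; rewrite inE.
  (* For a second dominating B' = K' x + E' with [E'] of range [e], one has H + (B' - F) = B + B'
     and B + (B' + F) = H + B' with all summands nondecreasing. On a null set the measure of [B']
     only sees [E'], so it is at most [e]. *)
  have both (e : R) : 0 < e -> (LS cH A <= LS cB A + e%:E)%E /\ (LS cB A <= LS cH A + e%:E)%E.
    move=> e0; have [K' [E' [K'0 E'h E'rc E'e FE']]] := ac_dominated_rc e0.
    pose cE' := cumulative_of E'h E'rc.
    have B'_nd : {homo (fun x : R => K' * x) \+ E' : x y / x <= y}.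
      by move=> x y xy; apply: lerD; [exact: ler_wpM2l|exact: (E'h)].
    pose cB' := cumulative_of B'_nd (add_rc (@lin_rc K') E'rc).
    have P_nd : {homo F \+ ((fun x : R => K' * x) \+ E') : x y / x <= y}.
      apply: dom_nd => x y xy /=; have := FE' x y xy.
      by rewrite ler_norml => /andP[h _]; lra.
    have M_nd : {homo (\- F) \+ ((fun x : R => K' * x) \+ E') : x y / x <= y}.
      apply: dom_nd => x y xy /=; have := FE' x y xy.
      by rewrite ler_norml => /andP[_ h]; lra.
    pose cP := cumulative_of P_nd (add_rc F_rc (add_rc (@lin_rc K') E'rc)).
    pose cM := cumulative_of M_nd (add_rc NF_rc (add_rc (@lin_rc K') E'rc)).
    pose cBB := cumulative_of (fun x y (xy : x <= y) => lerD (B_nd _ _ xy) (B'_nd _ _ xy))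
      (add_rc (add_rc (@lin_rc K) Erc) (add_rc (@lin_rc K') E'rc)).
    pose cHB := cumulative_of (fun x y (xy : x <= y) => lerD (H_nd _ _ xy) (B'_nd _ _ xy))
      (add_rc (add_rc F_rc (add_rc (@lin_rc K) Erc)) (add_rc (@lin_rc K') E'rc)).
    have B'A : (LS cB' A <= e%:E)%E.
      rewrite (stieltjesD (f := lin K' K'0) (g := cE'))//.
      rewrite (stieltjes_linear_null K'0)// add0e.
      apply: (@le_trans _ _ (LS cE' D)).
        by apply: le_measure => //; rewrite inE.
      rewrite stieltjes_itv ?lee_fin; last exact: ltW.
      by rewrite /=; have /andP[] := E'e c; have /andP[] := E'e d; lra.
    have e1 : LS cBB A = (LS cB A + LS cB' A)%E by exact: stieltjesD.
    have e2 : LS cBB A = (LS cH A + LS cM A)%E by apply: stieltjesD => // x /=; ring.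
    have e3 : LS cHB A = (LS cH A + LS cB' A)%E by exact: stieltjesD.
    have e4 : LS cHB A = (LS cB A + LS cP A)%E by apply: stieltjesD => // x /=; ring.
    split.
      apply: (@le_trans _ _ (LS cBB A)); first by rewrite e2 leeDl.
      by rewrite e1 leeD2l.
    apply: (@le_trans _ _ (LS cHB A)); first by rewrite e4 leeDl.
    by rewrite e3 leeD2l.
  by apply/eqP; rewrite eq_le; apply/andP; split; apply/lee_addgt0Pr => e /both[].
pose nH := charge_of_finite_measure (mfrestr mD (fin cH)).
pose nB := charge_of_finite_measure (mfrestr mD (fin cB)).
pose chi := cadd nH (copp nB).
have chiE A : chi A = (LS cH (A `&` D) - LS cB (A `&` D))%E by [].
have chi_dom : chi `<< lebR.
  apply/null_content_dominatesP => A mA A0; rewrite chiE null//.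
  - rewrite subee// ge0_fin_numE//; apply: le_lt_trans (fin cB).
    by apply: le_measure => //; rewrite inE//; exact: measurableI.
  - exact: measurableI.
  - apply/eqP; rewrite eq_le measure_ge0 andbT -A0.
    by apply: le_measure => //; rewrite inE//; exact: measurableI.
have sub (x y : R) : c <= x -> y <= d -> [set` `]x, y]] `<=` [set` `]c, d]].
  move=> cx yd z; rewrite /= !in_itv /= => /andP[xz zy].
  by rewrite (le_lt_trans cx xz) (le_trans zy yd).
have chi_itv x y : c <= x -> x <= y -> y <= d -> chi [set` `]x, y]] = (F y - F x)%:E.
  move=> cx xy yd; rewrite chiE setIidl; last exact: sub.
  by rewrite !stieltjes_itv// -EFinB /=; congr _%:E; ring.
have setE (y : R) : [set` `]-oo, y]] `&` [set` `]c, d]] = [set` `]c, y]] `&` [set` `]c, d]].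
  apply/seteqP; split => z; rewrite /= !in_itv /=.
    by move=> [zy /andP[cz zd]]; rewrite cz zy zd.
  by move=> [/andP[cz zy] /andP[_ zd]]; rewrite cz zy zd.
exists (fine \o Radon_Nikodym chi lebR); split.
  apply: eq_integrable (Radon_Nikodym_integrable chi_dom) => // x _.
  by rewrite /= fineK// Radon_Nikodym_fin_num.
move=> x y cx xy yd; split.
  under eq_integral do rewrite fineK ?Radon_Nikodym_fin_num//.
  by rewrite -Radon_Nikodym_integral//; exact: chi_itv.
under eq_integral do rewrite fineK ?Radon_Nikodym_fin_num//.
rewrite -Radon_Nikodym_integral//.
have cy : c <= y by exact: le_trans xy.
have <- : chi [set` `]c, y]] = (F y - F c)%:E by exact: chi_itv.
have : chi [set` `]-oo, y]] = chi [set` `]c, y]] by rewrite !chiE /D setE.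
exact.
Qed.

(** Near a point of ]c, d[, [F] is a constant plus the integral of [psi] from -oo, so Lebesgue
    differentiation applies. *)
Lemma ac_derivable_density (c d : R) : c < d -> exists psi : R -> R,
  [/\ lebR.-integrable setT (EFin \o psi),
   (forall x y, c <= x -> x <= y -> y <= d ->
     (\int[lebR]_(t in [set` `]x, y]]) (psi t)%:E = (F y - F x)%:E)%E) &
   {ae lebR, forall x, c < x < d -> derivable F x 1 /\ derive1 F x = psi x}].
Proof.
move=> cd; have [psi [ipsi psiE]] := ac_density cd.
exists psi; split => //; first by move=> x y cx xy yd; have [] := psiE _ _ cx xy yd.
have ipsiy y : lebR.-integrable [set` `]-oo, y]] (EFin \o psi).
  exact: integrableS ipsi.
have := FTC1Ny ipsiy (open_integrable_locally openT ipsi).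
apply: filterS; first exact: (ae_filter_ringOfSetsType lebR).
move=> x /= [dG GE] /andP[cx xd].
set G := fun x => _ in dG GE.
have nFG : \near x, F x = (G \+ cst (F c)) x.
  have : \forall z \near x, z \in `]c, d[.
    by apply: near_in_itvoo; rewrite in_itv/= cx.
  apply: filterS => z; rewrite in_itv /= => /andP[cz zd].
  have [_ h] := psiE z z (ltW cz) (lexx _) (ltW zd).
  by rewrite /G /= /Rintegral h /= subrK.
have dGc : derivable (G \+ cst (F c)) x 1 by apply: derivableD => //.
split.
  by apply: near_eq_derivable dGc => //; apply: filterS nFG => z ->.
rewrite derive1E (near_eq_derive _ nFG) ?oner_neq0// deriveD//.
by rewrite derive_cst addr0 -derive1E.
Qed.

End ac_density.

(** * The norm of the derivative *)

Section ge0_integral_ae.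
Import HBNNSimple.

(* No measurability is assumed: the integral of a nonnegative function is a
   supremum over the simple functions below it. *)
Lemma ge0_integral_ae_eqT d (T : measurableType d) (R : realType)
    (mu : {measure set T -> \bar R}) (f g : T -> \bar R) :
  (forall x, (0 <= f x)%E) -> (forall x, (0 <= g x)%E) ->
  {ae mu, forall x, f x = g x} ->
  (\int[mu]_x f x = \int[mu]_x g x)%E.
Proof.
have main (f' g' : T -> \bar R) : (forall x, (0 <= f' x)%E) -> (forall x, (0 <= g' x)%E) ->
    {ae mu, forall x, f' x = g' x} -> (\int[mu]_x f' x <= \int[mu]_x g' x)%E.
  move=> f0 g0 [N [mN N0 fgN]].
  rewrite [leLHS]ge0_integralTE// [leRHS]ge0_integralTE//.
  apply: ge_ereal_sup => _ [h /= hf <-].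
  have mNC : measurable (~` N) by exact: measurableC.
  pose h' := proj_nnsfun h mNC.
  have h'1 x : h' x = h x * \1_(~` N) x by [].
  have h'E x : ~ N x -> h' x = h x.
    by move=> nN; rewrite h'1 indicE mem_set ?mulr1.
  have h'N x : N x -> h' x = 0.
    by move=> Nx; rewrite h'1 indicE memNset ?mulr0//; exact.
  have -> : sintegral mu h = sintegral mu h'.
    rewrite -!integralT_nnsfun; apply: ge0_ae_eq_integral => //.
    - exact/measurable_EFinP.
    - exact/measurable_EFinP.
    - by move=> x _; rewrite lee_fin.
    - by move=> x _; rewrite lee_fin.
    - exists N; split => // x /= hx; apply: contrapT => nN; apply: hx => _.
      exact: (congr1 EFin (esym (h'E x nN))).
  apply: ereal_sup_ubound; exists h' => //= x.
  have [Nx|nN] := pselect (N x).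
    by apply: le_trans (g0 x); rewrite lee_fin -[leLHS]/(h' x) h'N.
  rewrite -[X in X%:E]/(h' x) h'E//; apply: le_trans (hf x) _.
  suff -> : f' x = g' x by [].
  by apply: contrapT => fg; apply: nN; exact: fgN.
move=> f0 g0 fg; apply/eqP; rewrite eq_le !main//.
by case: fg => N [mN N0 h]; exists N; split => // x /= gf; apply: h => fg; exact: gf.
Qed.

End ge0_integral_ae.

Section step_functions.
Variables (R : realType) (t : nat -> R).
Hypothesis t_inc : forall n, t n < t n.+1.
Local Notation lebR := (@lebesgue_measure R).

Definition step_fun (s : nat -> R) (M : nat) (x : R) : R :=
  \sum_(k < M) s k * \1_[set` `]t k, t k.+1]] x.

Let t_mono m n : (m <= n)%N -> t m <= t n.
Proof.
by move/subnK <-; elim: (n - m)%N => // k IH; rewrite addSn (le_trans IH)// ltW.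
Qed.

Let indicE k x : \1_[set` `]t k, t k.+1]] x = (t k < x <= t k.+1)%R%:R :> R.
Proof. by rewrite indicE mem_setE in_itv. Qed.

Lemma step_fun_in s M k x : (k < M)%N -> t k < x <= t k.+1 -> step_fun s M x = s k.
Proof.
move=> kM tx; rewrite /step_fun (bigD1 (Ordinal kM)) //= big1 ?addr0; last first.
  move=> i; rewrite -val_eqE /= => ik; rewrite indicE.
  case/andP: tx => tkx xtk; case: ltngtP ik => // ik _.
    by rewrite [X in _ && X]leNgt (le_lt_trans (t_mono ik) tkx) andbF mulr0.
  by rewrite ltNge (le_trans xtk (t_mono ik)) mulr0.
by rewrite indicE tx mulr1.
Qed.

Lemma step_fun_out s M x : (forall k, (k < M)%N -> ~ (t k < x <= t k.+1)) ->
  step_fun s M x = 0.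
Proof.
move=> h; apply: big1 => i _; rewrite indicE.
by have /negP/negbTE -> := h i (ltn_ord i); rewrite mulr0.
Qed.

Lemma step_fun_comp (phi : R -> R) s M x : phi 0 = 0 ->
  phi (step_fun s M x) = step_fun (phi \o s) M x.
Proof.
move=> phi0; have [[k [kM tx]]|h] := pselect (exists k, (k < M)%N /\ t k < x <= t k.+1).
  by rewrite !(step_fun_in _ kM tx).
have out k : (k < M)%N -> ~ (t k < x <= t k.+1) by move=> kM tx; apply: h; exists k.
by rewrite !step_fun_out.
Qed.

Lemma step_locate M x : t 0%N < x -> x <= t M -> exists k, (k < M)%N /\ t k < x <= t k.+1.
Proof.
elim: M => [|M IH] t0x xM; first by have := lt_le_trans t0x xM; rewrite ltxx.
have [xtM|tMx] := leP x (t M); last by exists M; rewrite tMx.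
by have [k [kM tx]] := IH t0x xtM; exists k; split => //; exact: ltnW.
Qed.

Lemma step_fun_measurable s M : measurable_fun setT (step_fun s M).
Proof.
by apply: measurable_sum => k; apply: measurable_funM => //; exact: measurable_indic.
Qed.

Lemma step_fun_integral s M : (forall k, 0 <= s k) ->
  (\int[lebR]_x (step_fun s M x)%:E = (\sum_(k < M) s k * (t k.+1 - t k))%:E)%E.
Proof.
move=> s0; under eq_integral do rewrite /step_fun -sumEFin.
rewrite ge0_integral_sum//.
- rewrite -sumEFin; apply: eq_bigr => k _; under eq_integral do rewrite EFinM.
  rewrite ge0_integralZl_EFin//.
  + rewrite integral_indic// setIT [RHS]EFinM; congr (_ * _)%E.
    exact: (stieltjes_itv _ (ltW (t_inc k))).
  + by apply/measurable_EFinP; exact: measurable_indic.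
- by move=> k; apply/measurable_EFinP; apply: measurable_funM => //; exact: measurable_indic.
- by move=> k x _; rewrite lee_fin mulr_ge0// indicE.
Qed.

End step_functions.

(** The first-order errors at [u] and [v] are at most e (x - u) and e (v - x), which add up to e (v
    - u). *)
Lemma derivable_straddle (R : realType) (F : R -> R) (x e : R) :
  derivable F x 1 -> 0 < e -> exists2 d : R, 0 < d &
  forall u v, u < x -> x <= v -> v - u < d -> `|(F v - F u) / (v - u) - derive1 F x| <= e.
Proof.
move=> dF e0; have : h^-1 *: (F (h *: 1 + x) - F x) @[h --> 0^'] --> 'D_1 F x := dF.
move=> /cvgrPdist_le/(_ e e0); rewrite derive1E; set D := 'D_1 F x.
move=> [d /= d0 hd]; exists d => // u v ux xv uv.
have key h : `|h| < d -> `|F (x + h) - F x - D * h| <= e * `|h|.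
  move=> hh; have [->|hN0] := eqVneq h 0.
    by rewrite addr0 mulr0 !subrr normr0 mulr0.
  have := hd h; rewrite /= sub0r normrN => /(_ hh hN0).
  rewrite /GRing.scale /= mulr1 [h + x]addrC => hk.
  have -> : F (x + h) - F x - D * h = - (D - h^-1 * (F (x + h) - F x)) * h.
    by field.
  by rewrite normrM normrN ler_wpM2r.
have vu0 : 0 < v - u by lra.
have k1 := key (v - x); have k2 := key (u - x).
rewrite !(addrC x) !subrK in k1 k2.
have {}k1 : `|F v - F x - D * (v - x)| <= e * (v - x).
  by have := k1; rewrite ger0_norm ?subr_ge0//; apply; lra.
have {}k2 : `|F u - F x - D * (u - x)| <= e * (x - u).
  by have := k2; rewrite ltr0_norm ?subr_lt0// opprB; apply; lra.
have -> : (F v - F u) / (v - u) - D =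
    ((F v - F x - D * (v - x)) - (F u - F x - D * (u - x))) / (v - u).
  by field; lra.
rewrite normrM normfV (gtr0_norm vu0) ler_pdivrMr//.
apply: le_trans (ler_normB _ _) _; lra.
Qed.

(** The graph of t^q lies above its tangent at [s]; this is Young's inequality with exponents q and
    q / (q - 1). *)
Lemma powR_tangent (R : realType) (q s u : R) : 1 <= q -> 0 <= s -> 0 <= u ->
  q * s `^ (q - 1) * u <= u `^ q + (q - 1) * s `^ q.
Proof.
rewrite le_eqVlt => /orP[/eqP <-|q1] s0 u0.
  by rewrite subrr powRr0 mul0r addr0 !mul1r powRr1.
have q0 : 0 < q by lra.
have q10 : 0 < q - 1 by lra.
have p0 : 0 < q / (q - 1) by rewrite divr_gt0.
have := @conjugate_powR R u (s `^ (q - 1)) q (q / (q - 1)) u0 (powR_ge0 _ _) q0 p0.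
rewrite -powRrM (_ : (q - 1) * (q / (q - 1)) = q); last by field; lra.
have -> : q^-1 + (q / (q - 1))^-1 = 1 by field; rewrite !gt_eqF.
move=> /(_ erefl); rewrite -(ler_pM2l q0) => h.
have e1 : q * (u `^ q / q + s `^ q / (q / (q - 1))) = u `^ q + (q - 1) * s `^ q.
  by field; rewrite !gt_eqF.
by rewrite e1 in h; apply: le_trans h; rewrite mulrAC mulrA.
Qed.

Lemma cvg_powR_nneg (R : realType) (q l : R) (u : nat -> R) : 1 <= q ->
  (forall n, 0 <= u n) -> 0 <= l -> u n @[n --> \oo] --> l ->
  u n `^ q @[n --> \oo] --> l `^ q.
Proof.
move=> q1 u0 l0 ul; apply/cvgrPdist_le => e e0.
have C0 : 0 < q * (l + 1) `^ (q - 1) by rewrite mulr_gt0 ?powR_gt0//; lra.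
(* Stated with both distances to [l], so that it covers [a = l] as well as [b = l]. *)
have tangent (a b : R) : 0 <= a -> 0 <= b -> b <= l + 1 ->
    b `^ q - a `^ q <= q * (l + 1) `^ (q - 1) * `|l - a| + q * (l + 1) `^ (q - 1) * `|b - l|.
  move=> a0 b0 bl; have := powR_tangent q1 b0 a0.
  have bq : b `^ q = b `^ (q - 1) * b.
    by rewrite mulrC mulr_powRB1//; lra.
  have h1 : q * b `^ (q - 1) * (b - a) <= q * (l + 1) `^ (q - 1) * `|b - a|.
    apply: le_trans (ler_wpM2l _ (ler_norm _)) _; first by rewrite mulr_ge0 ?powR_ge0//; lra.
    rewrite ler_wpM2r// ler_wpM2l//; first by lra.
    by apply: ge0_ler_powR; rewrite ?nnegrE; lra.
  have h2 : `|b - a| <= `|l - a| + `|b - l|.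
    have -> : b - a = (l - a) + (b - l) by ring.
    exact: ler_normD.
  have := ler_wpM2l (ltW C0) h2; rewrite mulrDr => h3.
  have : (q - 1) * b `^ q = q * b `^ (q - 1) * b - b `^ q by rewrite bq; ring.
  by move: h1; rewrite mulrBr; lra.
near=> n.
have un : `|l - u n| <= e / (q * (l + 1) `^ (q - 1)).
  by near: n; apply: (@cvgr_dist_le _ R^o) => //; exact: divr_gt0.
have un1 : u n <= l + 1.
  have : `|l - u n| <= 1 by near: n; exact: (@cvgr_dist_le _ R^o).
  by rewrite ler_norml => /andP[]; lra.
move: un; rewrite ler_pdivlMr// mulrC => un.
have := tangent _ _ (u0 n) l0 (ltac:(lra)); rewrite subrr normr0 mulr0 addr0 => k1.
have := tangent _ _ l0 (u0 n) un1; rewrite subrr normr0 mulr0 add0r distrC => k2.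
by rewrite ler_norml; apply/andP; split; lra.
Unshelve. all: by end_near. Qed.

Section riesz_norm.
Variables (R : realType) (F : R -> R) (q : R).
Hypothesis acF : ac_dominated F.
Hypothesis q1 : 1 <= q.
Local Notation lebR := (@lebesgue_measure R).

Let q0 : 0 < q. Proof. exact: lt_le_trans q1. Qed.

Lemma ac_dominated_derivable_ae : {ae lebR, forall x, derivable F x 1}.
Proof.
have /ae_foralln : forall n : nat,
    {ae lebR, forall x, - n.+1%:R < x < n.+1%:R -> derivable F x 1}.
  move=> n; have nn : - n.+1%:R < n.+1%:R :> R by apply: (@lt_trans _ _ 0); rewrite ?oppr_lt0.
  have [psi [_ _]] := ac_derivable_density acF nn.
  apply: filterS; first exact: (ae_filter_ringOfSetsType lebR).
  by move=> x h /h [].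
move=> dF; apply: (@filterS _ _ (ae_filter_ringOfSetsType lebR) _ _ _ dF).
move=> x h; apply: (h (Num.bound `|x|)).
have xb : `|x| < (Num.bound `|x|)%:R by exact: archi_boundP.
have : `|x| < (Num.bound `|x|).+1%:R by apply: lt_trans xb _; rewrite ltr_nat.
by rewrite ltr_norml.
Qed.

(** Mesh 1 / (n + 1) from -(n + 1); the point n + 1 is reached after 2 (n + 1)^2 steps. *)
Definition grid (n k : nat) : R := k%:R / n.+1%:R - n.+1%:R.

Definition grid_slope (n k : nat) : R :=
  (F (grid n k.+1) - F (grid n k)) / (grid n k.+1 - grid n k).

Definition grid_size (n : nat) : nat := (n.+1 * n.+1).*2.

Let gridS n k : grid n k.+1 - grid n k = n.+1%:R^-1.
Proof. by rewrite /grid -natr1 mulrDl; ring. Qed.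

Let grid_inc n k : grid n k < grid n k.+1.
Proof. by rewrite -subr_gt0 gridS invr_gt0. Qed.

Let grid0 n : grid n 0 = - n.+1%:R.
Proof. by rewrite /grid mul0r sub0r. Qed.

Let grid_last n : grid n (grid_size n) = n.+1%:R.
Proof.
rewrite /grid /grid_size -muln2 !natrM mulrAC mulfK ?pnatr_eq0//.
by ring.
Qed.

Local Notation S n := (step_fun (grid n) (grid_slope n) (grid_size n)).

Lemma grid_slope_cvg x : derivable F x 1 -> S n x @[n --> \oo] --> derive1 F x.
Proof.
move=> dF; apply/cvgrPdist_le => e e0; have [d d0 hd] := derivable_straddle dF e0.
near=> n.
have nx : `|x| < n.+1%:R.
  apply: (lt_trans (archi_boundP (normr_ge0 x))).
  rewrite ltr_nat ltnS; near: n; exact: nbhs_infty_ge.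
have nd : n.+1%:R^-1 < d by near: n; exact: near_infty_natSinv_lt (PosNum d0).
have [k [kM /andP[tx xt]]] : exists k, (k < grid_size n)%N /\ grid n k < x <= grid n k.+1.
  by apply: step_locate; rewrite ?grid0 ?grid_last; move: nx; rewrite ltr_norml => /andP[// _ /ltW].
rewrite (step_fun_in (grid_inc n) _ kM) ?tx// distrC; apply: hd => //.
by rewrite gridS.
Unshelve. all: by end_near. Qed.

Local Notation D x := ((`|derive1 F x| `^ q)%:E).

Let phi (u : R) : R := `|u| `^ q.

Let phi0 : phi 0 = 0.
Proof. by rewrite /phi normr0 powR0// gt_eqF. Qed.

Let phi_cvg x : derivable F x 1 ->
  (phi (S n x))%:E @[n --> \oo] --> D x.
Proof.
move=> dF; apply: cvg_EFin; first by near=> n.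
by apply: cvg_powR_nneg => //; apply: cvg_norm; exact: grid_slope_cvg.
Unshelve. all: by end_near. Qed.

Let phi_meas n : measurable_fun setT (fun x => (phi (S n x))%:E).
Proof.
apply/measurable_EFinP; apply: (measurableT_comp (measurable_powR _)).
by apply: measurableT_comp => //; exact: step_fun_measurable.
Qed.

(** The integral of |S n|^q is exactly the Riesz sum of [F] over the grid, and [S n] tends to the
    derivative almost everywhere. *)
Lemma derive_norm_le (B : R) :
  (forall s : seq R, sorted <%R s -> \sum_(n < (size s).-1)
     `|F s`_n.+1 - F s`_n| `^ q / `|s`_n.+1 - s`_n| `^ (q - 1) <= B) ->
  (\int[lebR]_x D x <= B%:E)%E.
Proof.
move=> FB.
have int_le n : (\int[lebR]_x (phi (S n x))%:E <= B%:E)%E.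
  under eq_integral do rewrite step_fun_comp//.
  rewrite step_fun_integral//; last by move=> k; exact: powR_ge0.
  rewrite lee_fin; set M := grid_size n.
  have [s [srt sz snth]] : exists s : seq R, [/\ sorted <%R s, size s = M.+1 &
      forall i, (i <= M)%N -> s`_i = grid n i].
    exists [seq grid n k | k <- iota 0 M.+1]; split.
    - have h : forall m k, path <%R (grid n k) [seq grid n i | i <- iota k.+1 m].
        by elim=> //= m IH k; rewrite grid_inc IH.
      exact: (h M 0%N).
    - by rewrite size_map size_iota.
    - by move=> i iM; rewrite (nth_map 0%N) ?size_iota ?ltnS// nth_iota ?ltnS.
  have := FB _ srt; rewrite sz /=.
  apply: le_trans; rewrite le_eqVlt; apply/orP; left; apply/eqP; apply: eq_bigr => -[k kM] _ /=.
  rewrite !snth//; last exact: ltnW.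
  rewrite /grid_slope gridS.
  have i0 : 0 < n.+1%:R^-1 :> R by rewrite invr_gt0.
  rewrite /phi normrM normfV [`|_^-1|]gtr0_norm// powRM//.
  set h := n.+1%:R^-1 in i0 *; rewrite -mulrA; congr (_ * _).
  have -> : h^-1 `^ q = (h `^ q)^-1.
    by rewrite -powR_inv1 ?(ltW i0)// -powRrM mulN1r powRN.
  rewrite -(mulr_powRB1 (ltW i0) q0) invfM mulrAC mulVf ?mul1r// gt_eqF//.
have dae := ac_dominated_derivable_ae.
(* The integrand is replaced by the lower limit of the measurable functions |S n|^q, to which
   Fatou's lemma applies. *)
rewrite (@ge0_integral_ae_eqT _ _ _ lebR _ (fun x => limn_einf (fun n => (phi (S n x))%:E))).
- apply: le_trans (fatou _ _ _ _) _ => //.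
  + by move=> n x _; rewrite lee_fin powR_ge0.
  + rewrite limn_einf_lim; apply: lime_le; first exact: is_cvg_einfs.
    near=> n; apply: le_trans (int_le n).
    by apply: ereal_inf_lbound; exists n => /=.
- by move=> x; rewrite lee_fin powR_ge0.
- move=> x; rewrite limn_einf_lim; apply: lime_ge; first exact: is_cvg_einfs.
  near=> n; apply: le_ereal_inf_tmp => _ [k /= _ <-].
  by rewrite lee_fin powR_ge0.
- move: dae; apply: filterS; first exact: (ae_filter_ringOfSetsType lebR).
  by move=> x /phi_cvg /cvg_limn_einf_sup[-> _].
Unshelve. all: by end_near. Qed.

(** Jensen's inequality for the density [psi]. The upper limit is a measurable representative of the
    q-th power of the derivative, independent of the interval. *)
Lemma derive_norm_itv (a b : R) : a < b ->
  ((`|F b - F a| `^ q / (b - a) `^ (q - 1))%:E <=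
   \int[lebR]_(x in [set` `]a, b]]) limn_esup (fun n => (phi (S n x))%:E))%E.
Proof.
move=> ab; have [psi [ipsi psiE psi_ae]] := ac_derivable_density acF ab.
have mI : measurable ([set` `]a, b]] : set R) by exact: measurable_itv.
have mpsi : measurable_fun [set: R] psi.
  by have /measurable_int/measurable_EFinP := ipsi.
have mphi : measurable_fun [set: R] (fun x => (phi (psi x))%:E).
  apply/measurable_EFinP; apply: (measurableT_comp (measurable_powR _)).
  exact: measurableT_comp.
have phi_ge0 x : (0 <= (phi (psi x))%:E)%E by rewrite lee_fin powR_ge0.
rewrite (@ge0_ae_eq_integral _ _ _ lebR _ _ (fun x => (phi (psi x))%:E)) //; last 4 first.
- by apply: measurable_funTS; apply: measurable_fun_limn_esup.
- exact: measurable_funTS.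
- move=> x _; rewrite limn_esup_lim; apply: lime_ge; first exact: is_cvg_esups.
  near=> n; apply: (@le_trans _ _ (phi (S n x))%:E); first by rewrite lee_fin powR_ge0.
  by apply: ereal_sup_ubound; exists n => /=.
(* The density is identified with the derivative only inside ]a, b[, so the end point is discarded
   as a null set. *)
- have b0 : {ae lebR, forall x, x != b}.
    exists [set b]; split; [exact: measurable_set1|exact: lebesgue_measure_set1|].
    by move=> x /= /negP/negPn/eqP.
  move: psi_ae b0; apply: filterS2; first exact: (ae_filter_ringOfSetsType lebR).
  move=> x h xb /=; rewrite in_itv /= => /andP[ax xb'].
  have [dF <-] : derivable F x 1 /\ derive1 F x = psi x.
    by apply: h; rewrite ax lt_neqAle xb.
  by have [_ ->] := cvg_limn_einf_sup (phi_cvg dF).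
(* The mean slope: integrating the tangent inequality of t^q at [s] over ]a, b] gives the bound. *)
set s := `|F b - F a| / (b - a).
have ba0 : 0 < b - a by rewrite subr_gt0.
have s0 : 0 <= s by rewrite divr_ge0// ltW.
have -> : `|F b - F a| `^ q / (b - a) `^ (q - 1) = s `^ q * (b - a).
  rewrite /s powRM ?invr_ge0 ?(ltW ba0)// -mulrA; congr (_ * _).
  have -> : (b - a)^-1 `^ q = ((b - a) `^ q)^-1.
    by rewrite -powR_inv1 ?(ltW ba0)// -powRrM mulN1r powRN.
  rewrite -(mulr_powRB1 (ltW ba0) q0) invfM mulrAC mulVf ?mul1r// gt_eqF//.
have lI : lebR [set` `]a, b]] = (b - a)%:E by exact: (stieltjes_itv _ (ltW ab)).
have c0 : 0 <= (q - 1) * s `^ q by rewrite mulr_ge0 ?powR_ge0// subr_ge0.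
have d0 : 0 <= q * s `^ (q - 1) by rewrite mulr_ge0 ?powR_ge0// ltW.
have mabs : measurable_fun [set` `]a, b]] (fun x => (`|psi x|)%:E).
  by apply: measurable_funTS; apply/measurable_EFinP; exact: measurableT_comp.
have i1 : ((q * s `^ (q - 1))%:E * \int[lebR]_(x in [set` `]a, b]]) (`|psi x|)%:E <=
    \int[lebR]_(x in [set` `]a, b]]) (phi (psi x))%:E + ((q - 1) * s `^ q * (b - a))%:E)%E.
  rewrite -ge0_integralZl_EFin// [X in (_ <= _ + X)%E]EFinM -lI -integral_cst//.
  rewrite -ge0_integralD//; last exact: measurable_funTS.
  apply: ge0_le_integral => //.
  - by move=> x _; rewrite mule_ge0.
  - exact: measurable_funeM.
  - by apply: emeasurable_funD => //; exact: measurable_funTS.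
  - by move=> x _; rewrite -EFinM -EFinD lee_fin; apply: powR_tangent.
have i2 : ((`|F b - F a|)%:E <= \int[lebR]_(x in [set` `]a, b]]) (`|psi x|)%:E)%E.
  rewrite -abse_EFin -(psiE a b)//; last exact: ltW.
  by apply: le_abse_integral => //; apply: measurable_funTS; exact/measurable_EFinP.
have i3 : ((q * s `^ q * (b - a))%:E <= (q * s `^ (q - 1))%:E *
    \int[lebR]_(x in [set` `]a, b]]) (`|psi x|)%:E)%E.
  apply: le_trans (lee_wpmul2l _ i2); last by rewrite lee_fin.
  rewrite -EFinM lee_fin -(mulr_powRB1 s0 q0) le_eqVlt; apply/orP; left; apply/eqP.
  by rewrite {1}/s; field; lra.
have {i1 i3} := le_trans i3 i1.
case: (\int[lebR]_(x in [set` `]a, b]]) (phi (psi x))%:E)%E => [r|_|].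
- by rewrite -EFinD !lee_fin; lra.
- by rewrite leey.
- by rewrite addNye.
Unshelve. all: by end_near. Qed.

(** The bounds on single intervals are added over disjoint half-open intervals, using the measurable
    representative [G]. *)
Lemma derive_norm_ge (s : seq R) : sorted <%R s ->
  ((\sum_(n < (size s).-1) `|F s`_n.+1 - F s`_n| `^ q / `|s`_n.+1 - s`_n| `^ (q - 1))%:E
   <= \int[lebR]_x D x)%E.
Proof.
move=> ss.
pose G x := limn_esup (fun n => (phi (S n x))%:E).
have mG : measurable_fun [set: R] G by exact: measurable_fun_limn_esup.
have G0 x : (0 <= G x)%E.
  rewrite /G limn_esup_lim; apply: lime_ge; first exact: is_cvg_esups.
  near=> n; apply: (@le_trans _ _ (phi (S n x))%:E); first by rewrite lee_fin powR_ge0.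
  by apply: ereal_sup_ubound; exists n => /=.
rewrite (@ge0_integral_ae_eqT _ _ _ lebR _ G) //; last first.
  move: ac_dominated_derivable_ae; apply: filterS; first exact: (ae_filter_ringOfSetsType lebR).
  by move=> x /phi_cvg /cvg_limn_einf_sup[_]; rewrite /G => ->.
have sub (z a b : R) : z <= a -> a < b ->
    [set` `]a, b]] `|` [set` `]b, +oo[] `<=` [set` `]z, +oo[].
  move=> za ab x [|]; rewrite /= !in_itv /= !andbT.
    by move=> /andP[ax _]; exact: le_lt_trans ax.
  by move=> bx; apply: le_lt_trans bx; exact: le_trans (ltW ab).
have disj (a b : R) : [disjoint [set` `]a, b]] & [set` `]b, +oo[]].
  apply/disj_setPS => x []; rewrite /= !in_itv /= !andbT => /andP[_ xb] bx.
  by have := lt_le_trans bx xb; rewrite ltxx.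
have chain z l : itv_chain z l ->
    ((\sum_(p <- l) riesz_term q F p)%:E <= \int[lebR]_(x in [set` `]z, +oo[]) G x)%E.
  elim: l z => [|[a b] l IH] z /=.
    by move=> _; rewrite big_nil; exact: integral_ge0.
  move=> /and3P[za ab /IH h]; rewrite big_cons EFinD.
  apply: le_trans (leeD (derive_norm_itv ab) h) _.
  rewrite -ge0_integral_setU//=.
  - apply: ge0_subset_integral => //.
    + exact: measurableU.
    + exact: measurable_funTS.
    + by move=> x _; exact: G0.
    + exact: (sub z a b za ab).
  - exact: measurable_funTS.
  - by move=> x _; exact: G0.
rewrite (@sum_zip_behead _ (fun a b => `|F b - F a| `^ q / `|b - a| `^ (q - 1))).
case: s ss => [|x s] /= ss; first by rewrite big_nil; exact: integral_ge0.
have cs := itv_chain_zip ss.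
have -> : \sum_(p <- zip (x :: s) s) `|F p.2 - F p.1| `^ q / `|p.2 - p.1| `^ (q - 1) =
    \sum_(p <- zip (x :: s) s) riesz_term q F p.
  rewrite big_seq [RHS]big_seq; apply: eq_bigr => p ps.
  have [_ pp] := itv_chain_mem cs ps.
  by rewrite /riesz_term [X in _ / X `^ _]ger0_norm// subr_ge0 ltW.
apply: le_trans (chain _ _ cs) _.
by apply: ge0_subset_integral => //; exact: measurable_funTS.
Unshelve. all: by end_near. Qed.

End riesz_norm.

(** * The maximal function of a function of bounded variation *)

Section bounded_variation_line.
Variables (R : realType) (f : R -> R).
Hypothesis f_bv : (total_variation_line f < +oo)%E.
Local Notation TV := total_variation.
Local Notation lebR := (@lebesgue_measure R).

Definition line_variation : R := fine (total_variation_line f).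

Let TV_le a b : a <= b -> (TV a b f <= total_variation_line f)%E.
Proof. by move=> ab; apply: ereal_sup_ubound; exists (a, b). Qed.

Lemma line_variationE : (line_variation%:E = total_variation_line f)%E.
Proof.
rewrite fineK// ge0_fin_numE//; apply: le_trans (TV_le (lexx 0)).
exact: total_variation_ge0.
Qed.

Let tv a b : R := fine (TV a b f).

Let tvE a b : a <= b -> (tv a b)%:E = TV a b f.
Proof.
move=> ab; rewrite fineK// ge0_fin_numE ?total_variation_ge0//.
exact: le_lt_trans (TV_le ab) f_bv.
Qed.

Let tv_le a b : a <= b -> tv a b <= line_variation.
Proof. by move=> ab; rewrite -lee_fin tvE// line_variationE TV_le. Qed.

Let tv_ge0 a b : a <= b -> 0 <= tv a b.
Proof. by move=> ab; rewrite -lee_fin tvE// total_variation_ge0. Qed.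

Let tvD a b c : a <= c -> c <= b -> tv a b = tv a c + tv c b.
Proof.
move=> ac cb; have ab := le_trans ac cb.
by apply/EFin_inj; rewrite EFinD !tvE// (total_variationD f ac cb).
Qed.

Let tv_dist a b : a <= b -> `|f b - f a| <= tv a b.
Proof. by move=> ab; rewrite -lee_fin tvE// total_variation_ge. Qed.

(** The variation of [f] on the half-line up to [x]. *)
Definition variation_below (x : R) : R :=
  sup [set tv ab.1 ab.2 | ab in [set ab : R * R | ab.1 <= ab.2 /\ ab.2 <= x]].

Let has_sup_below x :
  has_sup [set tv ab.1 ab.2 | ab in [set ab : R * R | ab.1 <= ab.2 /\ ab.2 <= x]].
Proof.
split; first by exists (tv x x), (x, x).
by exists line_variation => _ [ab /= [h _] <-]; exact: tv_le.
Qed.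

Lemma variation_below_ge0 x : 0 <= variation_below x.
Proof.
apply: le_trans (tv_ge0 (lexx x)) _; apply: (ub_le_sup (proj2 (has_sup_below x))).
by exists (x, x).
Qed.

Lemma variation_below_le x : variation_below x <= line_variation.
Proof.
apply: ge_sup; first by case: (has_sup_below x).
by move=> _ [ab /= [h _] <-]; exact: tv_le.
Qed.

(** Any compact interval to the left of [c] can be prolonged to [w], which adds at least
    [|f w - f u|] to its variation. *)
Lemma variation_below_dist c u w d : c <= u -> u <= w -> w <= d ->
  `|f w - f u| <= variation_below d - variation_below c.
Proof.
move=> cu uw wd; rewrite lerBrDr addrC -lerBrDr; apply: ge_sup; first by case: (has_sup_below c).
move=> _ [[a b] /= [ab bc] <-]; rewrite lerBrDr.
have bu := le_trans bc cu; have au := le_trans ab bu.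
have : tv a w <= variation_below d.
  apply: (ub_le_sup (proj2 (has_sup_below d))); exists (a, w) => //=.
  by split => //; exact: le_trans uw.
rewrite (tvD au uw) (tvD ab bu).
by have := tv_ge0 bu; have := tv_dist uw; lra.
Qed.

Lemma variation_below_nd : {homo variation_below : x y / x <= y}.
Proof.
by move=> x y xy; have := variation_below_dist (lexx x) xy (lexx y); have := normr_ge0 (f y - f x); lra.
Qed.

Lemma bv_bounded y : `|f y| <= `|f 0| + line_variation.
Proof.
have key a b : a <= b -> `|f b - f a| <= line_variation.
  by move=> ab; apply: le_trans (tv_dist ab) (tv_le ab).
have : `|f y - f 0| <= line_variation.
  by have [y0|y0] := leP y 0; [rewrite distrC|]; apply: key => //; exact: ltW.
have : `|f y| <= `|f y - f 0| + `|f 0| by rewrite -{1}(subrK (f 0) (f y)) ler_normD.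
lra.
Qed.

(** Jordan decomposition: [f] is a difference of two nondecreasing functions. *)
Lemma bv_measurable : measurable_fun setT f.
Proof.
have -> : f = variation_below \- (variation_below \- f) by apply/funext => x /=; ring.
apply: measurable_funB; apply: nondecreasing_measurable => //.
  exact: variation_below_nd.
move=> x y xy /=; have := variation_below_dist (lexx x) xy (lexx y).
by have := ler_norm (f y - f x); lra.
Qed.

Definition abs_integral (c d : R) : R := fine (\int[lebR]_(y in [set` `[c, d]]) (`|f y|)%:E)%E.

Let mabs (A : set (measurableTypeR R)) : measurable A ->
  measurable_fun A (fun y : R => (`|f y|)%:E).
Proof.
move=> mA; apply: measurable_funTS; apply/measurable_EFinP.
by apply: measurableT_comp => //; exact: bv_measurable.
Qed.

Let lenI (c d : R) : c <= d -> lebR [set` `[c, d]] = (d - c)%:E.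
Proof.
by move=> cd; rewrite lebesgue_measure_itv /= lte_fin lt_neqAle cd andbT; case: eqVneq => [->|]; rewrite ?subrr// EFinB.
Qed.

Let mI (c d : R) : measurable ([set` `[c, d]] : set (measurableTypeR R)).
Proof. exact: measurable_itv. Qed.

Let int_le (c d M : R) : c <= d -> (forall u, c <= u -> u <= d -> `|f u| <= M) ->
  (\int[lebR]_(y in [set` `[c, d]]) (`|f y|)%:E <= (M * (d - c))%:E)%E.
Proof.
move=> cd fM; rewrite EFinM -(lenI cd) -integral_cst//.
have M0 : 0 <= M by apply: le_trans (fM c (lexx _) cd).
apply: ge0_le_integral => //; first exact: mabs.
by move=> y /=; rewrite in_itv /= => /andP[cy yd]; rewrite lee_fin fM.
Qed.

Lemma abs_integralE c d : c <= d ->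
  ((abs_integral c d)%:E = \int[lebR]_(y in [set` `[c, d]]) (`|f y|)%:E)%E.
Proof.
move=> cd; rewrite fineK// ge0_fin_numE ?integral_ge0//.
by apply: le_lt_trans (int_le cd (fun u _ _ => bv_bounded u)) _; exact: ltry.
Qed.

Lemma abs_integral_le c d M : c <= d -> (forall u, c <= u -> u <= d -> `|f u| <= M) ->
  abs_integral c d <= M * (d - c).
Proof. by move=> cd fM; rewrite -lee_fin abs_integralE// int_le. Qed.

Lemma abs_integral_ge0 c d : 0 <= abs_integral c d.
Proof. by apply: fine_ge0; exact: integral_ge0. Qed.

Lemma abs_integral_ge c d M : c <= d -> (forall u, c <= u -> u <= d -> M <= `|f u|) ->
  M * (d - c) <= abs_integral c d.
Proof.
move=> cd fM; have [M0|M0] := leP M 0.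
  by apply: le_trans (abs_integral_ge0 c d); rewrite mulr_le0_ge0// subr_ge0.
rewrite -lee_fin abs_integralE// EFinM -(lenI cd) -integral_cst//.
apply: ge0_le_integral => //.
- by move=> y _; rewrite lee_fin ltW.
- exact: mabs.
- by move=> y /=; rewrite in_itv /= => /andP[cy yd]; rewrite lee_fin fM.
Qed.

Lemma abs_integralD c d e : c <= d -> d <= e ->
  abs_integral c e = abs_integral c d + abs_integral d e.
Proof.
move=> cd de; apply/EFin_inj; rewrite EFinD !abs_integralE//; last exact: le_trans de.
have mo : measurable ([set` `]d, e]] : set (measurableTypeR R)) by exact: measurable_itv.
have split_itv : [set` `[c, e]] = [set` `[c, d]] `|` [set` `]d, e]] :> set R.
  apply/seteqP; split => x /=; rewrite !in_itv /=.
    by move=> /andP[cx xe]; have [xd|dx] := leP x d; [left|right]; rewrite ?cx ?xe.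
  move=> [/andP[cx xd]|/andP[dx xe]]; first by rewrite cx (le_trans xd de).
  by rewrite xe (le_trans cd (ltW dx)).
have disj : [disjoint [set` `[c, d]] & ([set` `]d, e]] : set R)].
  apply/disj_setPS => x [] /=; rewrite !in_itv /= => /andP[_ xd] /andP[dx _].
  by have := lt_le_trans dx xd; rewrite ltxx.
rewrite -[X in (_ + X)%E](integral_itv_obnd_cbnd (mabs mo)) split_itv.
by rewrite ge0_integral_setU//; apply: mabs; exact: measurableU.
Qed.

(** Values of |f| on the two intervals differ by at most [D]; this is averaged first over [c, d],
    then over [e, g]. *)
Lemma abs_integral_osc c d e g : c < d -> d <= e -> e < g ->
  `|abs_integral c d / (d - c) - abs_integral e g / (g - e)| <=
  variation_below g - variation_below c.
Proof.
move=> cd de eg; set D := variation_below g - _.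
have dist u w : c <= u -> u <= d -> e <= w -> w <= g -> `| `|f u| - `|f w| | <= D.
  move=> cu ud ew wg; apply: le_trans (ler_dist_dist _ _) _; rewrite distrC.
  by apply: variation_below_dist => //; exact: le_trans ud (le_trans de ew).
have cd0 : 0 < d - c by rewrite subr_gt0.
have eg0 : 0 < g - e by rewrite subr_gt0.
have up w : e <= w -> w <= g -> abs_integral c d / (d - c) <= `|f w| + D.
  move=> ew wg; rewrite ler_pdivrMr//; apply: abs_integral_le; first exact: ltW.
  by move=> u cu ud; have := dist u w cu ud ew wg; rewrite ler_norml => /andP[]; lra.
have lo w : e <= w -> w <= g -> `|f w| - D <= abs_integral c d / (d - c).
  move=> ew wg; rewrite ler_pdivlMr//; apply: abs_integral_ge; first exact: ltW.
  by move=> u cu ud; have := dist u w cu ud ew wg; rewrite ler_norml => /andP[]; lra.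
have h1 : abs_integral c d / (d - c) - D <= abs_integral e g / (g - e).
  rewrite ler_pdivlMr//; apply: abs_integral_ge; first exact: ltW.
  by move=> w ew wg; have := up w ew wg; lra.
have h2 : abs_integral e g / (g - e) <= abs_integral c d / (d - c) + D.
  rewrite ler_pdivrMr//; apply: abs_integral_le; first exact: ltW.
  by move=> w ew wg; have := lo w ew wg; lra.
by rewrite ler_norml; apply/andP; split; lra.
Qed.

(** * Finiteness of the maximal function and the abstract data it satisfies *)

Section frac_maximal.
Variable beta : R.
Hypothesis beta_ge0 : 0 <= beta.
Hypothesis beta_lt1 : beta < 1.
Local Notation A c d := (abs_integral c d / (d - c) `^ (1 - beta)).

Lemma frac_maximal_ub x c d : c <= x -> x <= d -> c < d ->
  ((A c d)%:E <= frac_maximal beta f x)%E.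
Proof.
move=> cx xd cd; apply: ereal_sup_ubound; exists (x - c, d - x) => /=.
  by split; rewrite ?subr_ge0//; lra.
rewrite (_ : x - c + (d - x) = d - c); last by ring.
rewrite (_ : x - (x - c) = c); last by ring.
rewrite (_ : x + (d - x) = d); last by ring.
by rewrite -abs_integralE ?(ltW cd)// -EFinM mulrC.
Qed.

Lemma frac_maximal_le x (B : \bar R) :
  (forall c d, c <= x -> x <= d -> c < d -> ((A c d)%:E <= B)%E) ->
  (frac_maximal beta f x <= B)%E.
Proof.
move=> AB; apply: ge_ereal_sup => _ [[r s] /= [r0 s0 rs] <-].
have cd : x - r < x + s by lra.
rewrite -abs_integralE ?(ltW cd)// -EFinM mulrC (_ : r + s = x + s - (x - r)); last by ring.
by apply: AB => //; lra.
Qed.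

(** Intervals of length at most 1 are controlled by the bound on |f|. A longer one is enlarged to
    contain [x0], which multiplies its length by at most [1 + k], and finiteness at [x0] applies. *)
Lemma frac_maximal_fin_num : (exists x, frac_maximal beta f x <> +oo%E) ->
  forall x, frac_maximal beta f x \is a fin_num.
Proof.
have ge0 x : (0 <= frac_maximal beta f x)%E.
  have xx : x < x + 1 by rewrite ltrDl.
  apply: le_trans (frac_maximal_ub (lexx x) (ltW xx) xx).
  by rewrite lee_fin divr_ge0 ?abs_integral_ge0 ?powR_ge0.
move=> [x0 x0fin] x; rewrite ge0_fin_numE//.
have {}x0fin : frac_maximal beta f x0 \is a fin_num.
  by rewrite ge0_fin_numE// ltey; apply/eqP.
set B := fine (frac_maximal beta f x0).
have AB c d : c <= x0 -> x0 <= d -> c < d -> A c d <= B.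
  by move=> cx xd cd; rewrite -lee_fin fineK//; exact: frac_maximal_ub.
have B0 : 0 <= B by exact: fine_ge0.
have al0 : 0 <= 1 - beta by rewrite subr_ge0 ltW.
set C := `|f 0| + line_variation.
have C0 : 0 <= C by apply: le_trans (normr_ge0 (f 0)) (bv_bounded 0).
set k := `|x - x0|; have k0 : 0 <= k by exact: normr_ge0.
have Ck0 : 0 <= B * (1 + k) `^ (1 - beta) by rewrite mulr_ge0 ?powR_ge0.
apply: (@le_lt_trans _ _ (C + B * (1 + k) `^ (1 - beta))%:E); last exact: ltry.
apply: frac_maximal_le => c d cx xd cd; rewrite lee_fin.
have L0 : 0 < d - c by rewrite subr_gt0.
have P0 : 0 < (d - c) `^ (1 - beta) by exact: powR_gt0.
have [L1|L1] := leP (d - c) 1.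
  suff : A c d <= C by lra.
  rewrite ler_pdivrMr//.
  apply: le_trans (abs_integral_le (ltW cd) (fun u _ _ => bv_bounded u)) _.
  by apply: ler_wpM2l => //; apply: ger1_powR; rewrite ?L0 ?gerBl.
suff : A c d <= B * (1 + k) `^ (1 - beta) by lra.
have xk : `|x - x0| <= k by []; move: xk; rewrite ler_norml => /andP[xk1 xk2].
pose c' := Num.min c x0; pose d' := Num.max d x0.
have c'c : c' <= c by rewrite ge_min lexx.
have c'x : c' <= x0 by rewrite ge_min lexx orbT.
have dd' : d <= d' by rewrite le_max lexx.
have xd' : x0 <= d' by rewrite le_max lexx orbT.
have cd' : c' < d' by apply: le_lt_trans c'c (lt_le_trans cd dd').
have L' : d' - c' <= (d - c) * (1 + k).
  (* The length exceeds 1 here, so d - c + k <= (d - c) (1 + k). *)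
  have : d' - c' <= d - c + k.
    by rewrite /d' /c' maxEle minEle; do !case: ifPn; rewrite -?ltNge; lra.
  by nra.
have L'0 : 0 < d' - c' by rewrite subr_gt0.
rewrite ler_pdivrMr//.
apply: (@le_trans _ _ (abs_integral c' d')).
  have e1 := abs_integralD c'c (ltW (lt_le_trans cd dd')).
  have e2 := abs_integralD (ltW cd) dd'.
  by have := abs_integral_ge0 c' c; have := abs_integral_ge0 d d'; lra.
have := AB _ _ c'x xd' cd'; rewrite ler_pdivrMr ?powR_gt0// => h.
apply: (le_trans h); rewrite -mulrA; apply: ler_wpM2l => //.
have k10 : 0 <= 1 + k by rewrite addr_ge0.
have Lk0 : 0 <= (1 + k) * (d - c) by rewrite mulr_ge0 ?(ltW L0).
rewrite -powRM ?(ltW L0)//; apply: ge0_ler_powR; rewrite ?nnegrE ?(ltW L'0)//.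
by rewrite mulrC.
Qed.

Lemma frac_maximal_data : (forall x, frac_maximal beta f x \is a fin_num) ->
  fmax_data beta line_variation abs_integral variation_below
    (fun x => fine (frac_maximal beta f x)).
Proof.
move=> Ffin; split => //.
- by move=> c d _; exact: abs_integral_ge0.
- exact: abs_integralD.
- exact: variation_below_nd.
- exact: variation_below_ge0.
- exact: variation_below_le.
- exact: abs_integral_osc.
- by move=> x c d cx xd cd; rewrite -lee_fin fineK//; exact: frac_maximal_ub.
- move=> x e e0; apply: contrapT => no.
  have : (frac_maximal beta f x <= (fine (frac_maximal beta f x) - e)%:E)%E.
    apply: frac_maximal_le => c d cx xd cd; rewrite lee_fin leNgt; apply/negP => h.
    by apply: no; exists c, d.
  by rewrite -{1}(fineK (Ffin x)) lee_fin; lra.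
Qed.

End frac_maximal.

End bounded_variation_line.

(** * The norm as a Riesz variation, and the theorem *)

Lemma riesz_norm_eq (R : realType) (F : R -> R) (q : R) : ac_dominated F -> 1 <= q ->
  (riesz_variation q F < +oo)%E ->
  ('N[lebesgue_measure]_(q%:E)[EFin \o derive1 F] = riesz_variation q F)%E.
Proof.
move=> acF q1 Wfin; have q0 : 0 < q by exact: lt_le_trans q1.
have qV0 : 0 <= q^-1 by rewrite invr_ge0 ltW.
set W := riesz_variation q F.
have Wub s : sorted <%R s -> (((\sum_(n < (size s).-1) `|F s`_n.+1 - F s`_n| `^ q /
    `|s`_n.+1 - s`_n| `^ (q - 1)) `^ q^-1)%:E <= W)%E.
  by move=> ss; apply: ereal_sup_ubound; exists s.
have sum0 (s : seq R) : 0 <= \sum_(n < (size s).-1) `|F s`_n.+1 - F s`_n| `^ q /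
    `|s`_n.+1 - s`_n| `^ (q - 1).
  by apply: sumr_ge0 => i _; rewrite divr_ge0 ?powR_ge0.
have W0 : (0 <= W)%E.
  by apply: le_trans (Wub [::] isT); rewrite lee_fin powR_ge0.
have fW0 : 0 <= fine W by exact: fine_ge0.
have WE : W = (fine W)%:E by rewrite fineK// ge0_fin_numE.
rewrite unlock /=.
set I := (\int[_]_x _)%E.
have I_le : (I <= ((fine W) `^ q)%:E)%E.
  apply: (derive_norm_le acF q1) => s ss.
  have := Wub s ss; have := sum0 s; rewrite WE lee_fin.
  move: (\sum_(_ < _) _) => u u0 h.
  have -> : u = (u `^ q^-1) `^ q by rewrite -powRrM mulVf ?powRr1// gt_eqF.
  by apply: ge0_ler_powR; rewrite ?nnegrE ?powR_ge0 ?(ltW q0).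
have I0 : (0 <= I)%E by apply: integral_ge0 => x _; rewrite lee_fin powR_ge0.
have fI0 : 0 <= fine I by exact: fine_ge0.
have IE : I = (fine I)%:E by rewrite fineK// ge0_fin_numE//; apply: le_lt_trans I_le (ltry _).
rewrite IE poweR_EFin; apply/eqP; rewrite eq_le; apply/andP; split.
  rewrite WE lee_fin; rewrite IE lee_fin in I_le.
  have -> : fine W = (fine W `^ q) `^ q^-1.
    by rewrite -powRrM mulfV ?powRr1// gt_eqF.
  by apply: ge0_ler_powR; rewrite ?nnegrE ?powR_ge0.
apply: ge_ereal_sup => _ [s /= ss <-]; rewrite lee_fin.
have := derive_norm_ge acF q1 ss; rewrite -/I IE lee_fin.
by move: (sum0 s); move: (\sum_(_ < _) _) => u u0 uI; apply: ge0_ler_powR; rewrite ?nnegrE.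
Qed.

Unset Implicit Arguments.
Set Strict Implicit.
Set Printing Implicit Defensive.

Theorem theorem1 (R : realType) (beta q : R) (f : R -> R)
  (beta_ge0 : 0 <= beta) (beta_lt1 : beta < 1) (qE : q = 1 / (1 - beta))
  (f_bv : (total_variation_line f < +oo)%E)
  (Mf_not_oo : exists x : R, frac_maximal beta f x <> +oo%E) :
  let Mf : R -> R := (fun x => fine (frac_maximal beta f x)) in
  [/\ (forall x : R, frac_maximal beta f x \is a fin_num),
      abs_continuous Mf,
      {ae lebesgue_measure, forall x : R, derivable Mf x 1},
      ('N[lebesgue_measure]_(q%:E)[EFin \o derive1 Mf]
        = riesz_variation q Mf)%E
    & (riesz_variation q Mf <= (8 `^ (1 / q))%:E * total_variation_line f)%E].
Proof.
have qa : q * (1 - beta) = 1 by rewrite qE; field; lra.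
move=> Mf.
have Mfin := frac_maximal_fin_num f_bv beta_ge0 beta_lt1 Mf_not_oo.
have FD := frac_maximal_data f_bv beta_ge0 beta_lt1 Mfin.
have q1 := fmax_q_ge1 FD qa.
have acMf : ac_dominated Mf.
  (* As q (1 - beta) = 1, the case q = 1 is beta = 0; finite q-variation is then mere bounded
     variation, and the one-sided maximal function is needed. *)
  move: q1; rewrite le_eqVlt => /orP[/eqP q1|q1].
    have b0 : beta = 0 by move: qa; rewrite -q1; lra.
    by move: FD; rewrite b0 => FD; rewrite /Mf b0; exact: fmax0_ac_dominated FD.
  exact: riesz_ac_dominated q1 (fmax_chain_sum FD qa).
have var_le := fmax_riesz_variation_le FD qa.
split => //.
- exact: ac_dominated_abs_continuous.
- exact: ac_dominated_derivable_ae.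
- by apply: riesz_norm_eq => //; apply: le_lt_trans var_le (ltry _).
- by rewrite -line_variationE// -EFinM.
Qed.
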